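(* Let $\mathbb{T}$ be an almost periodic time scale and let $n\ge 1$. Consider the system $$x_i^\Delta(t)=-c_i(t)x_i(t)+\sum_{k=1,k\neq i}^n b_{ik}(t)x_k(t)+\sum_{j=1}^n\beta_{ij}(t)x_i(t-\tau_{ij}(t))e^{-\alpha_{ij}(t)x_i(t-\tau_{ij}(t))},\quad t\in\mathbb{T},\ i=1,\dots,n. \qquad (N)$$ Assume: (1) $c_i,b_{ik},\beta_{ij},\alpha_{ij},\tau_{ij}\in AP(\mathbb{T},\mathbb{R}^+)$, $c_i^->0$, $b_{ik}^->0$, $\beta_{ij}^->0$, $\alpha_{ij}^->0$, and $t-\tau_{ij}(t)\in\mathbb{T}$ for all $t\in\mathbb{T}$, $i,k,j=1,\dots,n$ (with $k\ne i$ for $b_{ik}$). (2) $A_1<A_2$ are positive constants satisfying $$A_2>\max_{1\le i\le n}\left\{\left[1-\sum_{k=1,k\ne i}^n\frac{b_{ik}^+}{c_i^-}\right]^{-1}\sum_{j=1}^n\frac{\beta_{ij}^+}{c_i^-\alpha_{ij}^-e}\right\}$$ and $$\min_{1\le i\le n}\left\{\left[1-\sum_{k=1,k\ne i}^n\frac{b_{ik}^-}{c_i^+}\right]^{-1}\sum_{j=1}^nA_2\frac{\beta_{ij}^-}{c_i^+}e^{-\alpha_{ij}^+A_2}\right\}>A_1\ge\frac{\varsigma}{\min_{1\le i,j\le n}\{\alpha_{ij}^-\}}.$$ (3) $-c_i\in\mathcal{R}^+$ for $i=1,\dots,n$. (4) $\displaystyle\sum_{k=1,k\ne i}^n b_{ik}^++\sum_{j=1}^n\frac{\beta_{ij}^+}{e^2}<c_i^-$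 for $i=1,\dots,n$. Then the positive almost periodic solution $x^*(t)$ of $(N)$ in the region $$\mathbb{B}^*=\{\varphi\in\mathbb{B}:\ A_1\le\varphi_i(t)\le A_2,\ t\in\mathbb{T},\ i=1,\dots,n\}$$ (which exists under these hypotheses) is unique and exponentially stable.
   Context: A time scale is a nonempty closed subset $\mathbb{T}\subset\mathbb{R}$, with $\sigma(t)=\inf\{s\in\mathbb{T}:s>t\}$, $\mu(t)=\sigma(t)-t$, and $x^\Delta$ the usual delta derivative; $[a,b]_{\mathbb{T}}=[a,b]\cap\mathbb{T}$ (similarly for other intervals). $\mathcal{R}^+$ is the set of rd-continuous $r:\mathbb{T}\to\mathbb{R}$ with $1+\mu(t)r(t)>0$ for all $t\in\mathbb{T}$. For $p\in\mathcal{R}^+$, $e_p(\cdot,s)$ is the time scale exponential function, the unique solution of $y^\Delta=p(t)y$, $y(s)=1$; and $\ominus\lambda=-\lambda/(1+\mu(t)\lambda)$. As a codomain, $\mathbb{R}^+$ denotes $[0,\infty)$. Almost periodic time scale: for $\tau\in\mathbb{T}$ put $\mathbb{T}_\tau=\mathbb{T}\cap\{t-\tau:t\in\mathbb{T}\}$. $\mathbb{T}$ is an almost periodic time scale if the set $\Pi:=\{\tau\in\mathbb{T}:\mathbb{T}_\tau\ne\emptyset\text{ and }\mathbb{T}_\tau\ne\{0\}\}$ satisfies $\Pi\ne\{0\}$ and: (i) $\Pi\neq\emptyset$; (ii) $\tau_1,\tau_2\in\Pi$ implies $\tau_1\pm\tau_2\in\Pi$; (iii) $\widetilde{\mathbb{T}}:=\bigcap_{\tau\in\Pi}\mathbb{T}_\tau\ne\emptyset$.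 Put $\widetilde\Pi=\{\tau\in\Pi: t\pm\tau\in\widetilde{\mathbb{T}}\ \text{for all } t\in\widetilde{\mathbb{T}}\}$. Almost periodic function: a bounded uniformly continuous $f$ on $\mathbb{T}$ (with values in $\mathbb{R}$ or $\mathbb{R}^n$) is almost periodic if for every $\varepsilon>0$ the set $\{\tau\in\widetilde\Pi:|f(t+\tau)-f(t)|<\varepsilon\ \forall t\in\widetilde{\mathbb{T}}\}$ is relatively dense, i.e. there is $l>0$ such that every interval of length $l$ in $\mathbb{R}$ contains an element of this set. $AP(\mathbb{T},\mathbb{R}^+)$ is the set of almost periodic functions $\mathbb{T}\to\mathbb{R}^+$. $\mathbb{B}$ is the set of almost periodic $\varphi=(\varphi_1,\dots,\varphi_n)\in C(\mathbb{T},\mathbb{R}^n)$. For a function $f:\mathbb{T}\to\mathbb{R}$: $f^+=\sup_{t\in\mathbb{T}}f(t)$, $f^-=\inf_{t\in\mathbb{T}}f(t)$. The constant $\varsigma\in(0,1)$ is the unique number in $(0,1)$ with $\frac{1-\varsigma}{e^\varsigma}=\frac1{e^2}$ ($\varsigma\approx0.7215354$). Let $\theta=\max_{(i,j)}\sup_{t\in\mathbb{T}}\tau_{ij}(t)$. For $t_0\in\mathbb{T}$, $C\{A_1,A_2\}$ is the set of $\varphi=(\varphi_1,\dots,\varphi_n)\in C([t_0-\theta,t_0]_{\mathbb{T}},\mathbb{R}^n)$ with $A_1\le\varphi_i(s)\le A_2$ for all $s\in[t_0-\theta,t_0]_{\mathbb{T}}$ and all $i$. A solution with initial value $\varphi$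 (at $t_0$) is one that equals $\varphi$ on $[t_0-\theta,t_0]_{\mathbb{T}}$ and satisfies $(N)$ for $t\ge t_0$, $t\in\mathbb{T}$. Exponential stability: let $x^*$ be an almost periodic solution of $(N)$ with initial value $\varphi^*\in C\{A_1,A_2\}$. It is exponentially stable if there exist constants $\lambda>0$ with $\ominus\lambda\in\mathcal{R}^+$ and $M>1$ such that every solution $x$ of $(N)$ with initial value $\varphi\in C\{A_1,A_2\}$ satisfies $$\|x(t)-x^*(t)\|\le M\|\varphi-\varphi^*\|_0\,e_{\ominus\lambda}(t,t_0),\qquad t_0\in[-\theta,\infty)_{\mathbb{T}},\ t\ge t_0,\ t\in\mathbb{T},$$ where $\|x(t)-x^*(t)\|=\max_{1\le i\le n}|x_i(t)-x_i^*(t)|$ and $\|\varphi-\varphi^*\|_0=\max_{1\le i\le n}\sup_{t\in[t_0-\theta,t_0]_{\mathbb{T}}}|\varphi_i(t)-\varphi_i^*(t)|$.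
   Formalization: Existence of x* in B* is assumed, not claimed: it can fail under (1)-(4), e.g. T=R, n=1, c=α=1, β=2.2, τ=0, A1=0.8, A2=1. For any given almost periodic solution x* in B*, uniqueness in B* and exponential stability are proved in full. *)

(* Defs.v *)
From HB Require Import structures.
From mathcomp Require Import all_boot all_order all_algebra.
From mathcomp Require Import all_classical all_reals all_analysis.

Set Implicit Arguments.
Unset Strict Implicit.
Unset Printing Implicit Defensive.

Import Order.TTheory GRing.Theory Num.Theory.
Import numFieldNormedType.Exports.

Local Open Scope classical_set_scope.
Local Open Scope ring_scope.

(* Functions on a time scale T are functions on the whole of R of which only
   the values on T are constrained. *)

Section TimeScale.
Context {R : realType}.
Implicit Types (T : set R) (f p : R -> R) (t s : R).

Definition time_scale T : Prop := T !=set0 /\ closed T.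

(* inf set0 = sup T and sup set0 = inf T by convention, so that sigma fixes
   max T and rho fixes min T when these exist. *)
Definition sigma T t : R :=
  if `[< exists2 s, T s & t < s >] then inf [set s | T s /\ t < s] else t.

Definition rho T t : R :=
  if `[< exists2 s, T s & s < t >] then sup [set s | T s /\ s < t] else t.

Definition mu T t : R := sigma T t - t.

Definition right_dense T t : Prop := (exists2 s, T s & t < s) /\ sigma T t = t.

Definition left_dense T t : Prop := (exists2 s, T s & s < t) /\ rho T t = t.

(* f^Delta(t) = d.  At a left-scattered maximum of T, where the delta
   derivative is undefined, every d qualifies; almost periodic time scales
   have no maximum. *)
Definition is_delta_derive T f t (d : R) : Prop :=
  forall eps : R, 0 < eps -> exists2 delta : R, 0 < delta &
    forall s, T s -> `|s - t| < delta ->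
      `|f (sigma T t) - f s - d * (sigma T t - s)| <= eps * `|sigma T t - s|.

Definition rd_continuous T f : Prop :=
  (forall t, T t -> right_dense T t -> f @ within T (nbhs t) --> f t) /\
  (forall t, T t -> left_dense T t -> cvg (f @ within T (at_left t))).

Definition positively_regressive T p : Prop :=
  rd_continuous T p /\ forall t, T t -> 0 < 1 + mu T t * p t.

Definition ominus T (lambda : R) : R -> R :=
  fun t => - lambda / (1 + mu T t * lambda).

Definition exp_ivp T p s (y : R -> R) : Prop :=
  (forall t, T t -> is_delta_derive T y t (p t * y t)) /\ y s = 1.

(* e_p(t, s): a solution of exp_ivp, chosen by xget; it is determined on T
   when p is positively regressive. *)
Definition ts_exp T p t s : R := xget (fun=> 0) [set y | exp_ivp T p s y] t.

Definition shift_inter T (tau : R) : set R :=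
  T `&` [set t - tau | t in T].

Definition ap_Pi T : set R :=
  [set tau | [/\ T tau, shift_inter T tau !=set0
                 & shift_inter T tau <> [set 0]]].

Definition ap_core T : set R := \bigcap_(tau in ap_Pi T) shift_inter T tau.

Definition almost_periodic_time_scale T : Prop :=
  [/\ time_scale T,
      ap_Pi T <> [set 0],
      ap_Pi T !=set0,
      (forall tau1 tau2, ap_Pi T tau1 -> ap_Pi T tau2 ->
         ap_Pi T (tau1 + tau2) /\ ap_Pi T (tau1 - tau2))
    & ap_core T !=set0].

Definition ap_Pi_core T : set R :=
  [set tau | ap_Pi T tau /\
     forall t, ap_core T t -> ap_core T (t + tau) /\ ap_core T (t - tau)].

Definition relatively_dense (A : set R) : Prop :=
  exists2 l : R, 0 < l &
    forall a : R, exists2 tau, A tau & a <= tau <= a + l.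

Definition almost_periodic (V : normedModType R) T (f : R -> V) : Prop :=
  [/\ bounded_set (f @` T),
      (forall eps : R, 0 < eps -> exists2 delta : R, 0 < delta &
         forall s t, T s -> T t -> `|s - t| < delta -> `|f s - f t| < eps)
    & forall eps : R, 0 < eps ->
        relatively_dense
          [set tau | ap_Pi_core T tau /\
             forall t, ap_core T t -> `|f (t + tau) - f t| < eps]].

(* AP(T, R^+), where R^+ = [0, +oo[. *)
Definition ap_nonneg T f : Prop :=
  almost_periodic T (f : R -> R^o) /\ forall t, T t -> 0 <= f t.

Definition supT T f : R := sup (f @` T).
Definition infT T f : R := inf (f @` T).

(* Used only for nonempty finite I, where sup and inf are attained. *)
Definition fmax (I : finType) (F : I -> R) : R := sup (range F).
Definition fmin (I : finType) (F : I -> R) : R := inf (range F).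

End TimeScale.

Section NicholsonSystem.
Context {R : realType} (T : set R) (n : nat).
Variables (c : 'I_n -> R -> R) (b beta alpha tau : 'I_n -> 'I_n -> R -> R).
Implicit Types (x phi : R -> 'rV[R]_n).

Definition nicholson_rhs x (i : 'I_n) (t : R) : R :=
  - c i t * x t ord0 i
  + \sum_(k < n | k != i) b i k t * x t ord0 k
  + \sum_(j < n) beta i j t * x (t - tau i j t) ord0 i
      * expR (- alpha i j t * x (t - tau i j t) ord0 i).

(* Delta derivatives are taken along S.  With S = [t0, +oo[ `&` T the
   derivative at t0 is one-sided, as usual for an initial value problem. *)
Definition solution_on (S : set R) x : Prop :=
  forall t i, S t ->
    is_delta_derive S (fun s => x s ord0 i) t (nicholson_rhs x i t).

Definition theta : R :=
  fmax (fun ij : 'I_n * 'I_n => supT T (tau ij.1 ij.2)).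

Definition initial_set (t0 : R) : set R :=
  T `&` [set s | t0 - theta <= s <= t0].

Definition initial_class (A1 A2 : R) (t0 : R) phi : Prop :=
  {within initial_set t0, continuous phi} /\
  forall s i, initial_set t0 s -> A1 <= phi s ord0 i <= A2.

Definition solution_with_initial_value (t0 : R) phi x : Prop :=
  (forall s, initial_set t0 s -> x s = phi s) /\
  solution_on (T `&` [set t | t0 <= t]) x.

Definition region (A1 A2 : R) : set (R -> 'rV[R]_n) :=
  [set phi : R -> 'rV[R]_n | almost_periodic T phi /\
             forall t i, T t -> A1 <= phi t ord0 i <= A2].

Definition vnorm (v : 'rV[R]_n) : R := fmax (fun i => `|v ord0 i|).

Definition initial_norm (t0 : R) (phi : R -> 'rV[R]_n) : R :=
  fmax (fun i => sup [set `|phi s ord0 i| | s in initial_set t0]).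

Definition exponentially_stable (A1 A2 : R) (xs : R -> 'rV[R]_n) : Prop :=
  exists lambda M : R,
    [/\ 0 < lambda, positively_regressive T (ominus T lambda), 1 < M
      & forall t0, T t0 -> - theta <= t0 ->
        forall phi x, initial_class A1 A2 t0 phi ->
          solution_with_initial_value t0 phi x ->
          forall t, T t -> t0 <= t ->
            vnorm (x t - xs t)
              <= M * initial_norm t0 (fun s => phi s - xs s)
                   * ts_exp T (ominus T lambda) t t0].

End NicholsonSystem.

(* Main.v *)
Require Import Defs.
From mathcomp Require Import all_boot all_order all_algebra.
From mathcomp Require Import all_classical all_reals all_analysis.
From mathcomp Require Import ring lra.

Import Order.TTheory GRing.Theory Num.Theory.
Import numFieldNormedType.Exports.
Local Open Scope classical_set_scope.
Local Open Scope ring_scope.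

(** The two claims are one estimate.  Let [x] be a solution that starts in
    [A1, A2] at time [t0] and [y] a solution with values in [A1, A2] from
    [t0 - theta] on; then [|x - y|] is bounded by its initial norm times a
    decaying exponential, with a rate that depends neither on [t0] nor on [x]
    and [y].  Stability is the case where [y] is the given almost periodic
    solution, and uniqueness follows by letting [t0] tend to minus infinity.

    Write [f x = x e^(- alpha x)].  For [alpha x >= varsigma] the slope of [f]
    is at most [e^-2] in absolute value, and with that slope the row
    condition [contraction] makes the maximum norm of [x - y] contract.  The
    difficulty is that [x] may leave [A1, A2] through its lower end, where [f]
    is steeper.  With [r = A2 / A1], the hypotheses on [A1] and [A2] keep [x]
    in [fl * A1, A2], where [fl] is the smaller of [1] and
    [r - ln r / varsigma] ([production_floor], [solution_range]).

    If [fl = 1] there is no dip.  If [fl < 1] the deviation is measured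
    against the weight [W x = min (A1, A1 + 7/4 (x - A1))], which is smaller
    where [f] is steeper: one shows [|x - y| <= N e(t) W(x)].  Let [L] be the
    absolute secant slope of [f] between the delayed values of [x] and [y].
    The estimate propagates because of two bounds on each delayed term,
    - [L W <= A1 e^-2] ([secant_weight_le]), and
    - [L W <= 7/4 (f x - f A2) + A1/2 (e^-2 + 1 / (alpha A2 e))]
      ([secant_weight_le_dip]).
    The first serves the branch [A1] of the minimum.  The second serves the
    other branch: after multiplication by [beta] and summation, [f A2] is
    controlled by the upper bound on [A1], and the last two terms, each with
    half weight, by [contraction] and by the lower bound on [A2]
    ([row_weight]).  Both bounds scale to inequalities about the single
    function [z e^(2 - z)], and these are proved with Taylor polynomials.

    On the time scale, all the estimates come from one comparison principle
    ([barrier]): functions [u_k >= 0] at [t0] stay nonnegative if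
    [u_k^Delta + c_k u_k > 0] as long as all of them have been nonnegative.
    The exponential is the infimum of the products of the factors
    [1 / (1 + lambda h)] over finite chains of steps [h] in the time scale;
    every solution of its initial value problem dominates this one. *)

(** * The scaled Ricker map *)

Section RickerMap.
Set Implicit Arguments.
Unset Strict Implicit.
Context {R : realType}.
Implicit Types x y z w a b v : R.

Lemma derive_sign_min (f df : R -> R) (c : R) :
  (forall x : R, is_derive x 1 f (df x)) ->
  (forall x, c <= x -> 0 <= df x) -> (forall x, x <= c -> df x <= 0) ->
  forall x, f c <= f x.
Proof.
move=> fdf df_ge df_le x.
have fc : continuous f.
  by move=> u; apply: differentiable_continuous; apply/derivable1_diffP; apply: ex_derive.
have fW a b : {within `[a, b], continuous f} by apply: continuous_subspaceT.
case: (leP c x) => [cx|xc].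
  have [e /andP[ce _] fE] := MVT_segment cx (fun u _ => fdf u) (fW c x).
  by rewrite -subr_ge0 fE mulr_ge0 ?subr_ge0// df_ge.
have [e /andP[_ ec] fE] := MVT_segment (ltW xc) (fun u _ => fdf u) (fW x c).
by rewrite -subr_le0 fE mulr_le0_ge0 ?subr_ge0 ?(ltW xc)// df_le.
Qed.

Lemma expR_ge_taylor3 x : 1 + x + x ^+ 2 / 2 + x ^+ 3 / 6 <= expR x.
Proof.
pose f1 y := expR y - (1 + y + y ^+ 2 / 2).
pose f2 y := expR y - (1 + y + y ^+ 2 / 2 + y ^+ 3 / 6).
have d1 y : is_derive y 1 f1 (expR y - (1 + y)).
  by apply: is_derive_eq; rewrite /GRing.scale/=; field.
have d2 y : is_derive y 1 f2 (f1 y).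
  by apply: is_derive_eq; rewrite /GRing.scale/= /f1; field.
have fc : continuous f1.
  by move=> u; apply: differentiable_continuous; apply/derivable1_diffP; apply: ex_derive.
have fW a b : {within `[a, b], continuous f1} by apply: continuous_subspaceT.
have f10 : f1 0 = 0 by rewrite /f1 expR0; field.
have := @derive_sign_min f2 f1 0 d2 _ _ x.
rewrite /f2 expR0 => h.
suff : 0 <= expR x - (1 + x + x ^+ 2 / 2 + x ^+ 3 / 6) by lra.
have : 1 - (1 + 0 + 0 ^+ 2 / 2 + 0 ^+ 3 / 6) = 0 :> R by field.
move=> <-; apply: h => y y0.
  have [e _ fE] := MVT_segment y0 (fun u _ => d1 u) (fW 0 y).
  rewrite f10 subr0 in fE; rewrite fE mulr_ge0 ?subr_ge0//.
  exact: expR_ge1Dx.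
have [e _ fE] := MVT_segment y0 (fun u _ => d1 u) (fW y 0).
rewrite f10 sub0r in fE; rewrite -oppr_ge0 fE mulr_ge0 ?subr_ge0//.
exact: expR_ge1Dx.
Qed.

Lemma expR1_bounds : 27 / 10 <= expR (1 : R) <= 273 / 100.
Proof.
have up (x : R) : expR (4%:R * x) = expR x ^+ 4 by rewrite -expRM_natl.
have e1 : expR 1 = expR (1 / 4) ^+ 4 :> R by rewrite -up; congr expR; field.
have eN : expR (-1) = expR (- (1 / 4)) ^+ 4 :> R by rewrite -up; congr expR; field.
have t1 := expR_ge_taylor3 (1 / 4); have t2 := expR_ge_taylor3 (- (1 / 4)).
have h1 : (513 / 400) <= expR (1/4) :> R by lra.
have h2 : (389 / 500) <= expR (-(1/4)) :> R by lra.
have g1 : (513 / 400) ^+ 4 <= expR 1 :> R by rewrite e1 lerXn2r// nnegrE; lra.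
have g2 : (389 / 500) ^+ 4 <= expR (-1) :> R by rewrite eN lerXn2r// nnegrE; lra.
have e0 := @expR_gt0 R 1.
have ee : expR 1 * expR (-1) = 1 :> R by rewrite -expRD subrr expR0.
apply/andP; split; first by lra.
nra.
Qed.

(** [e^2 alpha] times the production [x e^(- alpha x)], as a function of
    [z = alpha x].  The factor [e^2] makes 1 the largest slope beyond
    varsigma; [ricker_slope] is minus the derivative, so that it is positive
    on the decreasing branch. *)
Definition ricker z : R := z * expR (2 - z).
Definition ricker_slope z : R := (z - 1) * expR (2 - z).

Lemma is_derive_ricker z : is_derive z 1 ricker (- ricker_slope z).
Proof.
by rewrite /ricker; apply: is_derive_eq; rewrite /GRing.scale/= /ricker_slope; ring.
Qed.

Lemma ricker_mvt a b : a <= b ->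
  exists2 c, a <= c <= b & ricker a - ricker b = ricker_slope c * (b - a).
Proof.
move=> ab.
have fc : continuous ricker.
  move=> u; apply: differentiable_continuous; apply/derivable1_diffP.
  by case: (is_derive_ricker u).
have fW : {within `[a, b], continuous ricker} by apply: continuous_subspaceT.
have [c] := MVT_segment ab (fun u _ => is_derive_ricker u) fW.
by rewrite in_itv/= => cab fE; exists c => //; rewrite -opprB fE mulNr opprK.
Qed.

Lemma ricker2 : ricker 2 = 2.
Proof. by rewrite /ricker subrr expR0 mulr1. Qed.

Lemma ricker_ge0 z : 0 <= z -> 0 <= ricker z.
Proof. by move=> z0; rewrite mulr_ge0// expR_ge0. Qed.

Lemma ricker_le_e z : ricker z <= expR 1.
Proof.
have h := expR_ge1Dx (z - 1).
have -> : expR 1 = expR (z - 1) * expR (2 - z) by rewrite -expRD; congr expR; lra.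
by rewrite ler_wpM2r ?expR_ge0//; lra.
Qed.

(** The slope is largest at the inflection point 2, where it equals 1; this is
    [z - 1 <= e^(z - 2)]. *)
Lemma ricker_slope_le1 z : ricker_slope z <= 1.
Proof.
have h := expR_ge1Dx (z - 2).
have <- : expR (z - 2) * expR (2 - z) = 1.
  by rewrite -expRD (_ : z - 2 + (2 - z) = 0) ?expR0//; ring.
by rewrite ler_wpM2r ?expR_ge0//; lra.
Qed.

Lemma ricker_slope_nincr a b : 2 <= a -> a <= b -> ricker_slope b <= ricker_slope a.
Proof.
move=> a2 ab; rewrite /ricker_slope.
have -> : 2 - a = (b - a) + (2 - b) by ring.
rewrite expRD mulrA ler_wpM2r ?expR_ge0//.
have h := expR_ge1Dx (b - a).
have : (a - 1) * (1 + (b - a)) <= (a - 1) * expR (b - a) by rewrite ler_wpM2l//; lra.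
by apply: le_trans; nra.
Qed.

Lemma ricker_nincr a b : 1 <= a -> a <= b -> ricker b <= ricker a.
Proof.
move=> a1 ab; have [c /andP[ac _] h] := ricker_mvt ab.
rewrite -subr_ge0 h mulr_ge0 ?subr_ge0// mulr_ge0 ?expR_ge0//.
by rewrite subr_ge0 (le_trans a1).
Qed.

Lemma ricker_ndecr a b : b <= 1 -> a <= b -> ricker a <= ricker b.
Proof.
move=> b1 ab; have [c /andP[_ cb] h] := ricker_mvt ab.
rewrite -subr_le0 h mulr_le0_ge0 ?subr_ge0// mulr_le0_ge0 ?expR_ge0//.
by rewrite subr_le0 (le_trans cb).
Qed.

Lemma ricker_convex p y b : 2 <= p -> p <= y -> y <= b ->
  (b - p) * ricker y <= (b - y) * ricker p + (y - p) * ricker b.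
Proof.
move=> p2 py yb.
have [c1 /andP[pc1 c1y] h1] := ricker_mvt py.
have [c2 /andP[yc2 c2b] h2] := ricker_mvt yb.
have k12 : ricker_slope c2 <= ricker_slope c1.
  by apply: ricker_slope_nincr; [exact: le_trans pc1|exact: le_trans yc2].
have : 0 <= (b - y) * (y - p) * (ricker_slope c1 - ricker_slope c2).
  by rewrite !mulr_ge0// ?subr_ge0.
have -> : (b - y) * (y - p) * (ricker_slope c1 - ricker_slope c2) =
  (b - y) * (ricker_slope c1 * (y - p)) - (y - p) * (ricker_slope c2 * (b - y)) by ring.
by rewrite -h1 -h2; lra.
Qed.

(** The hypothesis says that [v] is varsigma: the Ricker map has derivative
    exactly 1 there.  Since [(1 - v) e^(2 - v)] decreases, two evaluations
    locate [v]. *)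
Lemma varsigma_bounds v : (1 - v) * expR (2 - v) = 1 -> 18 / 25 <= v <= 73 / 100.
Proof.
move=> hv.
have up (x : R) : expR (4%:R * x) = expR x ^+ 4 by rewrite -expRM_natl.
have v1 : v < 1.
  rewrite -subr_gt0 -(pmulr_lgt0 _ (expR_gt0 (2 - v))) hv.
  exact: ltr01.
have t1 := expR_ge_taylor3 (8 / 25); have t2 := expR_ge_taylor3 (- (8 / 25)).
have h1 : 11 / 8 <= expR (8 / 25) :> R by lra.
have h2 : 29 / 40 <= expR (- (8 / 25)) :> R by lra.
have g1 : (11 / 8) ^+ 4 <= expR (32 / 25) :> R.
  by rewrite (_ : 32 / 25 = 4 * (8 / 25)) ?up ?lerXn2r ?nnegrE//; lra.
have g2 : (29 / 40) ^+ 4 <= expR (- (32 / 25)) :> R.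
  by rewrite (_ : - (32 / 25) = 4 * - (8 / 25)) ?up ?lerXn2r ?nnegrE//; lra.
apply/andP; split; rewrite leNgt; apply/negP => hlt.
  have e1 : expR (32 / 25) <= expR (2 - v) by rewrite ler_expR; lra.
  have e2 : (7 / 25) * expR (32 / 25) < (1 - v) * expR (2 - v).
    apply: (@lt_le_trans _ _ ((1 - v) * expR (32 / 25))).
      by rewrite ltr_pM2r ?expR_gt0//; lra.
    by rewrite ler_wpM2l//; lra.
  by move: e2; rewrite hv; lra.
have e1 : expR (2 - v) <= expR (32 / 25) by rewrite ler_expR; lra.
have e2 : (1 - v) * expR (2 - v) <= (1 - v) * expR (32 / 25) by rewrite ler_wpM2l//; lra.
have e3 : (1 - v) * expR (32 / 25) < (27 / 100) * expR (32 / 25).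
  by rewrite ltr_pM2r ?expR_gt0//; lra.
have e4 : expR (32 / 25) * expR (- (32 / 25)) = 1 :> R by rewrite -expRD subrr expR0.
have e5 := @expR_gt0 R (32 / 25).
have : expR (32 / 25) * (29 / 40) ^+ 4 <= expR (32 / 25) * expR (- (32 / 25)) :> R.
  by rewrite ler_wpM2l// ltW.
rewrite e4.
by move: e2 e3; rewrite hv; lra.
Qed.

Lemma ricker_slope_norm_le1 v z : (1 - v) * expR (2 - v) = 1 -> v <= z ->
  `|ricker_slope z| <= 1.
Proof.
move=> hv vz; have /andP[_ v1] := varsigma_bounds hv.
rewrite ler_norml ricker_slope_le1 andbT.
case: (leP 1 z) => z1.
  apply: (@le_trans _ _ 0); first by lra.
  by rewrite mulr_ge0 ?expR_ge0//; lra.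
rewrite lerNl -mulNr -[leRHS]hv ler_pM ?expR_ge0//; [lra|lra|].
by rewrite ler_expR; lra.
Qed.

Lemma ricker_lipschitz_on (k m : R) z w : (forall c, m <= c -> `|ricker_slope c| <= k) ->
  m <= z -> m <= w -> `|ricker z - ricker w| <= k * `|z - w|.
Proof.
move=> hk; wlog zw : z w / z <= w => [hw vz vw|vz vw].
  case: (leP z w) => zw; first exact: hw.
  by rewrite distrC (distrC z); apply: hw => //; exact: ltW.
have [c /andP[zc _] ->] := ricker_mvt zw.
by rewrite normrM (distrC z) ler_wpM2r// hk// (le_trans vz).
Qed.

Lemma ricker_lipschitz v z w : (1 - v) * expR (2 - v) = 1 -> v <= z -> v <= w ->
  `|ricker z - ricker w| <= `|z - w|.
Proof.
move=> hv vz vw; rewrite -[leRHS]mul1r; apply: (ricker_lipschitz_on (m := v)) => // c.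
exact: ricker_slope_norm_le1.
Qed.

End RickerMap.

(** * Secants of the Ricker map *)

Section RickerSecants.
Set Implicit Arguments.
Unset Strict Implicit.
Context {R : realType}.
Implicit Types z w a v r q k y : R.

(** Bounds the growth of the Ricker map just below varsigma.  Multiplying by
    [1 - v] removes [e^(2 - v)], and the right side is what remains of
    [v - z e^(v - z)] after a second order expansion. *)
Lemma ricker_drop_le v z : (1 - v) * expR (2 - v) = 1 -> 0 <= z -> z <= v ->
  (1 - v) * (ricker v - ricker z) <=
  (v - z) * ((1 - v) + (v - z) * (1 - v / 2) + (v - z) ^+ 2 / 2).
Proof.
move=> hv z0 zv; have /andP[v0 v1] := varsigma_bounds hv.
have vE : (1 - v) * ricker v = v by rewrite /ricker mulrCA hv mulr1.
have zE : (1 - v) * ricker z = z * expR (v - z).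
  have eD : expR (2 - z) = expR (2 - v) * expR (v - z).
    by rewrite -expRD; congr expR; ring.
  by rewrite /ricker eD mulrCA [(1 - v) * _]mulrA hv mul1r.
rewrite mulrBr vE zE.
have t3 : 1 + (v - z) + (v - z) ^+ 2 / 2 <= expR (v - z).
  apply: le_trans (expR_ge_taylor3 _).
  by rewrite lerDl divr_ge0// exprn_ge0// subr_ge0.
have : z * (1 + (v - z) + (v - z) ^+ 2 / 2) <= z * expR (v - z) by rewrite ler_wpM2l.
have d0 : 0 <= v - z by rewrite subr_ge0.
have : 0 <= (v - z) ^+ 3 by rewrite exprn_ge0.
by nra.
Qed.

Lemma varsigma_weight_ge0 v : 18 / 25 <= v <= 73 / 100 ->
  0 <= 7 / 4 * (1 - v) - v * (1 - v / 2).
Proof.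
move=> /andP[v0 v1]; have : (v - 18 / 25) * (v - 73 / 100) <= 0.
  by rewrite mulr_ge0_le0 ?subr_ge0 ?subr_le0.
by nra.
Qed.

(** The weight [min (a, a + 7/4 (z - a))] cancels the excess of the secant
    slope over 1 when [z] lies below varsigma.  To first order in [d = v - z]
    the slope is [1 + d (1 - v/2) / (1 - v)] and the weight, relative to [v],
    is [1 - 7/4 d / v], so the slope 7/4 has to exceed
    [v (1 - v/2) / (1 - v)] ([varsigma_weight_ge0]). *)
Lemma ricker_secant_weight v a z w : (1 - v) * expR (2 - v) = 1 ->
  v <= a -> 0 <= z -> v <= w ->
  `|ricker z - ricker w| * Num.min a (a + 7 / 4 * (z - a)) <= a * `|z - w|.
Proof.
move=> hv va z0 vw; have /andP[v0 v1] := varsigma_bounds hv.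
set W := Num.min _ _.
have Wa : W <= a by rewrite ge_min lexx.
have W2 : W <= a + 7 / 4 * (z - a) by rewrite ge_min lexx orbT.
case: (leP v z) => vz.
  apply: (@le_trans _ _ (`|ricker z - ricker w| * a)); first by rewrite ler_wpM2l.
  by rewrite mulrC ler_wpM2l ?(ricker_lipschitz hv)//; lra.
case: (leP 0 W) => W0; last first.
  apply: (@le_trans _ _ 0); first by rewrite mulr_ge0_le0// ltW.
  by rewrite mulr_ge0//; lra.
have zw : z <= w by lra.
rewrite [`|z - w|]distrC (ger0_norm (_ : 0 <= w - z)) ?subr_ge0//.
have D0 : ricker z <= ricker v by apply: ricker_ndecr; lra.
have := ricker_lipschitz hv (lexx v) vw.
rewrite [`|v - w|]distrC (ger0_norm (_ : 0 <= w - v)) ?subr_ge0// ler_norml.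
move=> /andP[L1 L2].
case: (leP (ricker w) (ricker z)) => gwz.
  rewrite ger0_norm ?subr_ge0//.
  apply: (@le_trans _ _ ((w - z) * a)); last by rewrite mulrC.
  by apply: ler_pM; rewrite ?subr_ge0//; lra.
rewrite distrC gtr0_norm ?subr_gt0//.
have main : (ricker v - ricker z) * W <= a * (v - z).
  have dip := ricker_drop_le hv z0 (ltW vz).
  set D := ricker v - ricker z in dip *.
  have D00 : 0 <= D by rewrite subr_ge0.
  have h1 : D * W <= D * (v - 7 / 4 * (v - z)).
    apply: ler_wpM2l => //; lra.
  case: (leP 0 (v - 7 / 4 * (v - z))) => q0; last first.
    apply: (le_trans h1); apply: (@le_trans _ _ 0).
      by rewrite mulr_ge0_le0// ltW.
    by rewrite mulr_ge0//; lra.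
  apply: (@le_trans _ _ (v * (v - z))); last by rewrite ler_wpM2r//; lra.
  apply: (le_trans h1).
  rewrite -(@ler_pM2l _ (1 - v)); last by lra.
  rewrite mulrA.
  apply: (le_trans (ler_wpM2r q0 dip)).
  set d := v - z in q0 *.
  have d0 : 0 <= d by rewrite /d; lra.
  have -> : (1 - v) * (v * d) = d * (v * (1 - v)) by ring.
  rewrite -[leLHS]mulrA; apply: ler_wpM2l => //.
  have e1 : 0 <= d * (7 / 4 * (1 - v) - v * (1 - v / 2)).
    by rewrite mulr_ge0 ?varsigma_weight_ge0// v0 v1.
  have e2 : 0 <= d ^+ 2 * (7 / 4 * (1 - v / 2) - v / 2) by rewrite mulr_ge0 ?exprn_ge0//; lra.
  have e3 : 0 <= d ^+ 3 by rewrite exprn_ge0.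
  by lra.
have : (ricker w - ricker v) * W <= (w - v) * a.
  apply: (@le_trans _ _ ((w - v) * W)); first by rewrite ler_wpM2r//; lra.
  by rewrite ler_wpM2l// subr_ge0.
by lra.
Qed.

(** The centre [m = 3] is precise enough for [z <= 17/5] and the centre [m = 4]
    beyond. *)
Lemma ricker_lower (e0 : R) (m : nat) z : 0 <= e0 -> e0 <= expR (2 - m%:R) -> 0 <= z ->
  z * (e0 * (1 + (m%:R - z) + (m%:R - z) ^+ 2 / 2 + (m%:R - z) ^+ 3 / 6)) <= ricker z.
Proof.
move=> e00 e0m z0; rewrite /ricker ler_wpM2l//.
have -> : expR (2 - z) = expR (2 - m%:R) * expR (m%:R - z).
  by rewrite -expRD; congr expR; ring.
apply: (@le_trans _ _ (e0 * expR (m%:R - z))).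
  by rewrite ler_wpM2l// expR_ge_taylor3.
by rewrite ler_wpM2r// expR_ge0.
Qed.

Lemma expRN1_ge : 15 / 41 <= expR (- (1 : R)).
Proof.
have /andP[e1 e2] := @expR1_bounds R.
have ee : expR 1 * expR (-1) = 1 :> R by rewrite -expRD subrr expR0.
have : 0 <= expR (-1) * (273 / 100 - expR 1) :> R by rewrite mulr_ge0 ?expR_ge0 ?subr_ge0.
by lra.
Qed.

Lemma ricker_lower3 z : 0 <= z ->
  z * (15 / 41 * (1 + (3 - z) + (3 - z) ^+ 2 / 2 + (3 - z) ^+ 3 / 6)) <= ricker z.
Proof.
move=> z0; apply: (@ricker_lower (15 / 41) 3 z _ _ z0); first by lra.
by rewrite (_ : 2 - 3 = -1) ?expRN1_ge//; ring.
Qed.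

Lemma ricker_lower4 z : 0 <= z ->
  z * (2 / 15 * (1 + (4 - z) + (4 - z) ^+ 2 / 2 + (4 - z) ^+ 3 / 6)) <= ricker z.
Proof.
move=> z0; apply: (@ricker_lower (2 / 15) 4 z _ _ z0); first by lra.
have h := expRN1_ge.
have -> : expR (2 - 4) = expR (-1) * expR (-1) :> R by rewrite -expRD; congr expR; ring.
apply: (@le_trans _ _ (15 / 41 * (15 / 41))); first by lra.
by apply: ler_pM => //; lra.
Qed.

(** With [p = z - 3], the inequality of [ricker_defect_diag] after the lower
    bound [ricker_lower3]. *)
Lemma defect_diag_poly3 (p : R) : - (3/10) <= p -> p <= 4/10 ->
 ((3 + p) / 2 - 2 / 3) * (3/10+p) <= (3 + p) * ((3 + p) * (15 / 41 * (1 - p + p ^+ 2 / 2 - p ^+ 3 / 6))) + (3+p)*(p-1).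
Proof.
move=> h1 h2.
have a1 : 0 <= p * (1 - p - p ^+ 2 / 3) + 4 / 10 by nra.
have : 0 <= p ^+ 2 * (p * (1 - p - p ^+ 2 / 3) + 4 / 10) by rewrite mulr_ge0 ?sqr_ge0.
nra.
Qed.

(** With [p = z - 4], the inequality of [ricker_defect_diag] after the lower
    bound [ricker_lower4]. *)
Lemma defect_diag_poly4 (p : R) : - (6/10) <= p -> p <= 1 ->
 ((4 + p) / 2 - 2 / 3) * (13/10+p) <= (4 + p) * ((4 + p) * (2 / 15 * (1 - p + p ^+ 2 / 2 - p ^+ 3 / 6))) + (4+p) * p.
Proof.
move=> h1 h2.
have a1 : 0 <= p * (1/3 - 5 / 6 * p - p ^+ 2 / 6) + 2 / 3 by nra.
have : 0 <= p ^+ 2 * (p * (1/3 - 5 / 6 * p - p ^+ 2 / 6) + 2 / 3) by rewrite mulr_ge0 ?sqr_ge0.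
nra.
Qed.

(** With [p = z - 3], the inequality of [ricker_defect_end] after the lower
    bound [ricker_lower3]. *)
Lemma defect_end_poly3 (p : R) : - 1 <= p -> p <= 4/10 ->
  13/2*(1-p) + 408/100*((3+p)/2-2/3) <= (13/2+7/2*((3 + p) / 2 - 2 / 3)) * ((3 + p) * (15 / 41 * (1 - p + p ^+ 2 / 2 - p ^+ 3 / 6))).
Proof.
move=> h1 h2.
have a1 : 0 <= (p + 1) * (4/10 - p) by nra.
have : 0 <= p ^+ 2 * ((p + 1) * (4/10 - p) * (11 + 2 * p)) by rewrite mulr_ge0 ?sqr_ge0//; nra.
have : 0 <= p ^+ 2 * (p+1) by rewrite mulr_ge0 ?sqr_ge0//; lra.
have := sqr_ge0 p.
nra.
Qed.

(** With [p = z - 4], the inequality of [ricker_defect_end] after the lower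
    bound [ricker_lower4]. *)
Lemma defect_end_poly4 (p : R) : - (6/10) <= p -> p <= 3/2 ->
  13/2*(-p) + 408/100*((4+p)/2-2/3) <= (13/2+7/2*((4 + p) / 2 - 2 / 3)) * ((4 + p) * (2 / 15 * (1 - p + p ^+ 2 / 2 - p ^+ 3 / 6))).
Proof.
move=> h1 h2.
set X := (1 + p) * (67 / 6 + 7 / 4 * p).
have x1 : 0 <= X by rewrite /X; nra.
have x2 : X <= 35 by rewrite /X; nra.
have p2 := sqr_ge0 p.
set h := 2/15*(71/12) + p * (2/15*(7/4) - 2/15/6 * X).
have p3 := sqr_ge0 (p + 6 / 10).
case: (leP 0 p) => p0.
  have a1 : 0 <= h + 1 / 5 by rewrite /h; nra.
  have : 0 <= p ^+ 2 * (h + 1 / 5) by rewrite mulr_ge0.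
  rewrite /h /X; nra.
have a1 : 0 <= h - 1 / 2 by rewrite /h; nra.
have : 0 <= p ^+ 2 * (h - 1 / 2) by rewrite mulr_ge0.
rewrite /h /X; nra.
Qed.

(** [ricker_defect_ge] at the left end [y = z]. *)
Lemma ricker_defect_diag z : 27 / 10 <= z -> z <= 13 / 2 ->
  (z / 2 - 2 / 3) * (z - 27 / 10) <= z * (ricker z + z - 4).
Proof.
move=> z1 z2; have z0 : 0 <= z by lra.
case: (leP z (17 / 5)) => z3.
  have := @defect_diag_poly3 (z - 3) ltac:(lra) ltac:(lra).
  have := ler_wpM2l z0 (ricker_lower3 z0).
  by lra.
case: (leP z 5) => z4.
  have := @defect_diag_poly4 (z - 4) ltac:(lra) ltac:(lra).
  have := ler_wpM2l z0 (ricker_lower4 z0).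
  by lra.
have := mulr_ge0 z0 (ricker_ge0 z0).
have : 0 <= (z - 5) * (z - 5) by rewrite mulr_ge0// subr_ge0 ltW.
by lra.
Qed.

(** [ricker_defect_ge] at the right end [y = 13/2], with 2/25 in place of the
    value of the Ricker map there ([ricker_far]). *)
Lemma ricker_defect_end z : 2 <= z -> z <= 13 / 2 ->
  (z / 2 - 2 / 3) * (13 / 2 - 27 / 10 - 7 / 2 * (ricker z - 2 / 25)) <=
  13 / 2 * (ricker z + z - 4).
Proof.
move=> z1 z2; have z0 : 0 <= z by lra.
have c0 : 0 <= 13 / 2 + 7 / 2 * (z / 2 - 2 / 3) by lra.
case: (leP z (17 / 5)) => z3.
  have := @defect_end_poly3 (z - 3) ltac:(lra) ltac:(lra).
  have := ler_wpM2l c0 (ricker_lower3 z0).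
  by lra.
case: (leP z (11 / 2)) => z4.
  have := @defect_end_poly4 (z - 4) ltac:(lra) ltac:(lra).
  have := ler_wpM2l c0 (ricker_lower4 z0).
  by lra.
have := mulr_ge0 c0 (ricker_ge0 z0).
by lra.
Qed.

Lemma ricker_far : ricker (13 / 2) <= 2 / 25 :> R.
Proof.
have /andP[e1 _] := @expR1_bounds R.
have h := @expR_ge_taylor3 R (1 / 2).
have hh : 8 / 5 <= expR (1 / 2) :> R by lra.
have e4 : 52 <= expR 4 :> R.
  have -> : expR 4 = expR 1 ^+ 4 :> R by rewrite -expRM_natl mulr1.
  apply: (@le_trans _ _ ((27 / 10) ^+ 4)); first by lra.
  by rewrite lerXn2r// nnegrE; lra.
have e92 : 82 <= expR (9 / 2) :> R.
  rewrite (_ : 9 / 2 = 4 + 1 / 2); last by field.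
  rewrite expRD; apply: (@le_trans _ _ (52 * (8 / 5))); first by lra.
  by apply: ler_pM => //; lra.
rewrite /ricker (_ : 2 - 13 / 2 = - (9 / 2)); last by field.
rewrite expRN ler_pdivrMr ?expR_gt0//; lra.
Qed.

(** [4 - z] is the tangent at the inflection point 2, above which the Ricker
    map is convex. *)
Lemma ricker_defect_ge0 z : 2 <= z -> 0 <= ricker z + z - 4.
Proof.
move=> z2; have [c _ h] := ricker_mvt z2.
have := ler_wpM2r (_ : 0 <= z - 2) (ricker_slope_le1 c).
rewrite -h ricker2 subr_ge0 => /(_ z2); lra.
Qed.

(** With [rho] as in [ricker_secant_from], this is
    [rho (z/2 - 2/3) <= ricker z + z - 4]: the height of the graph above the
    inflection tangent is large enough to flatten every secant from [z].  The
    difference of the two sides is convex in [y] because the Ricker map is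
    convex beyond 2, so it suffices to look at the ends of the range of [y]. *)
Lemma ricker_defect_ge y z : 27 / 10 <= y -> y <= 13 / 2 -> 2 <= z -> z <= y ->
  (z / 2 - 2 / 3) * (y - 27 / 10 - 7 / 2 * (ricker z - ricker y)) <= y * (ricker z + z - 4).
Proof.
move=> y1 y2 z2 zy.
have c0 : 0 <= z / 2 - 2 / 3 by lra.
have ez := ricker_defect_ge0 z2.
pose h t := (z / 2 - 2 / 3) * (t - 27 / 10 - 7 / 2 * (ricker z - ricker t)) - t * (ricker z + z - 4).
suff : h y <= 0 by rewrite /h; lra.
(* The left end of the range of y is the larger of z and 27/10. *)
have [p [p2 py hp]] : exists p, [/\ 2 <= p, p <= y & h p <= 0].
  case: (leP (27 / 10) z) => z1.
    exists z; split => //.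
    have := ricker_defect_diag z1 (le_trans zy y2).
    by rewrite /h subrr; lra.
  exists (27 / 10); split => //; first by lra.
  have g1 : ricker (27 / 10) <= ricker z by apply: ricker_nincr; lra.
  have := mulr_ge0 c0 (_ : 0 <= ricker z - ricker (27 / 10)).
  rewrite subr_ge0 => /(_ g1) g2.
  by rewrite /h; lra.
have hb : h (13 / 2) <= 0.
  have := ricker_defect_end z2 (le_trans zy y2).
  have := ler_wpM2l c0 ricker_far.
  by rewrite /h; lra.
have cvx := ler_wpM2l c0 (ricker_convex p2 py y2).
case: (leP (13 / 2) p) => pb.
  by have -> : y = 13 / 2 by apply: le_anti; rewrite y2/=; exact: le_trans py.
rewrite -(pmulr_rle0 _ (_ : 0 < 13 / 2 - p)); last by lra.
have k1 : (13 / 2 - y) * h p <= 0 by rewrite mulr_ge0_le0// subr_ge0.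
have k2 : (y - p) * h (13 / 2) <= 0 by rewrite mulr_ge0_le0// subr_ge0.
apply: (@le_trans _ _ ((13 / 2 - y) * h p + (y - p) * h (13 / 2))); last by lra.
by rewrite /h; lra.
Qed.

(** Multiplied by [e^(-q)], the claim follows from the cubic lower bound for
    [e^(-q)]. *)
Lemma ricker_slope_below2 q : 0 <= q -> q <= 1 -> ricker_slope (2 - q) <= 1 - q ^+ 2 / 2.
Proof.
move=> q0 q1; rewrite /ricker_slope (_ : 2 - (2 - q) = q); last by ring.
have t := expR_ge_taylor3 (- q).
have ee : expR q * expR (- q) = 1 by rewrite -expRD subrr expR0.
have p0 : 0 <= 1 - q ^+ 2 / 2.
  have : q * q <= 1 * 1 by apply: ler_pM.
  by rewrite expr2; lra.
rewrite -(ler_pM2r (expR_gt0 (- q))) -mulrA ee mulr1.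
apply: (le_trans _ (ler_wpM2l p0 t)).
have : 0 <= q ^+ 3 * (1 - q) by rewrite mulr_ge0 ?exprn_ge0// subr_ge0.
have : 0 <= q ^+ 3 by rewrite exprn_ge0.
have : 0 <= q ^+ 5 by rewrite exprn_ge0.
by lra.
Qed.

Lemma ricker_below2 q : 0 <= q -> q <= 1 -> ricker (2 - q) <= 2 + q - q ^+ 3 / 6.
Proof.
move=> q0 q1.
pose F t : R := t - t ^+ 3 / 6 - ricker (2 - t).
have dF (t : R) : is_derive t 1 F (1 - t ^+ 2 / 2 - ricker_slope (2 - t)).
  rewrite /F /ricker; apply: is_derive_eq.
  by rewrite /ricker_slope /GRing.scale/=; field.
have fc : continuous F.
  by move=> u; apply: differentiable_continuous; apply/derivable1_diffP; case: (dF u).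
have fW : {within `[0, q], continuous F} by apply: continuous_subspaceT.
have [c] := MVT_segment q0 (fun u _ => dF u) fW.
rewrite in_itv/= => /andP[c0 cq] FE.
have : 0 <= F q - F 0.
  rewrite FE mulr_ge0// ?subr_ge0//.
  exact: (ricker_slope_below2 c0 (le_trans cq q1)).
by rewrite /F subr0 ricker2; lra.
Qed.

(** Secants that start at [z >= 2] are flatter than the inflection tangent.
    For end points [2 - q] with [0 <= q <= 1], [ricker_below2] and
    [ricker_defect_ge] reduce the claim to [q^3 + 2 rho - 3 rho q >= 0], which
    holds for [0 <= rho <= 1].  Convexity beyond 2 reduces the other end points
    to [q = 0]. *)
Lemma ricker_secant_from y z w : 27 / 10 <= y -> y <= 13 / 2 -> 2 <= z -> z <= y -> 1 <= w ->
  let rho := 1 - (27 / 10 + 7 / 2 * (ricker z - ricker y)) / y in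
  0 <= rho -> `|ricker z - ricker w| <= (1 - rho / 2) * `|z - w|.
Proof.
move=> y1 y2 z2 zy w1 rho rho0.
have y0 : 0 < y by lra.
have G0 : ricker y <= ricker z by apply: ricker_nincr; lra.
have rho1 : rho <= 1.
  rewrite /rho gerBl divr_ge0 ?(ltW y0)//; lra.
have gap : (z / 2 - 2 / 3) * rho <= ricker z + z - 4.
  rewrite -(ler_pM2l y0); apply: le_trans (ricker_defect_ge y1 y2 z2 zy).
  rewrite /rho le_eqVlt; apply/orP; left; apply/eqP; field.
  by rewrite gt_eqF.
clearbody rho; clear y1 y2 zy G0 y0.
have s0 : 0 <= 1 - rho / 2 by lra.
have below q : 0 <= q -> q <= 1 -> ricker (2 - q) - ricker z <= (1 - rho / 2) * (q + (z - 2)).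
  move=> q0 q1; have up := ricker_below2 q0 q1.
  have cub : 0 <= q ^+ 3 + 2 * rho - 3 * rho * q.
    (* For q > 2/3 the bound rho <= 1 leaves (q - 1)^2 (q + 2) >= 0. *)
    case: (leP q (2 / 3)) => q2.
      have := mulr_ge0 rho0 (_ : 0 <= 2 / 3 - q).
      by rewrite subr_ge0 => /(_ q2) h; have := exprn_ge0 3 q0; lra.
    have : 0 <= (q - 1) ^+ 2 * (q + 2) by rewrite mulr_ge0 ?sqr_ge0//; lra.
    have : 0 <= (1 - rho) * (3 * q - 2) by rewrite mulr_ge0//; lra.
    by lra.
  by lra.
have sec2 : ricker 2 - ricker z <= (1 - rho / 2) * (z - 2).
  by have := below 0 (lexx _) ler01; rewrite subr0 add0r.
case: (leP w 2) => w2.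
  have zw : w <= z by exact: le_trans z2.
  rewrite distrC ger0_norm ?subr_ge0; last exact: ricker_nincr.
  rewrite ger0_norm ?subr_ge0//.
  have := below (2 - w) _ _; rewrite (_ : 2 - (2 - w) = w); last by ring.
  by rewrite (_ : 2 - w + (z - 2) = z - w); [apply; lra|ring].
have [z2E|z2'] : z = 2 \/ 2 < z by case: (ltgtP z 2) z2 => //; [right|left].
  have rho00 : rho = 0 by move: gap; rewrite z2E ricker2; lra.
  rewrite rho00 mul0r subr0 mul1r; have zw : z <= w by rewrite z2E ltW.
  have [c _ h] := ricker_mvt zw.
  rewrite ger0_norm; last by rewrite subr_ge0 ricker_nincr//; lra.
  rewrite distrC ger0_norm ?subr_ge0// h.
  by rewrite -[leRHS]mul1r ler_wpM2r ?subr_ge0// ricker_slope_le1.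
have d0 : 0 < z - 2 by rewrite subr_gt0.
case: (leP w z) => zw.
  rewrite distrC ger0_norm ?subr_ge0; last by apply: ricker_nincr; lra.
  rewrite ger0_norm ?subr_ge0// -(ler_pM2l d0).
  have := ricker_convex (lexx 2) (ltW w2) zw.
  have := ler_wpM2l (_ : 0 <= z - w) sec2; rewrite subr_ge0 => /(_ zw).
  by lra.
rewrite ger0_norm ?subr_ge0; last by apply: ricker_nincr; lra.
rewrite distrC ger0_norm ?subr_ge0 ?(ltW zw)// -(ler_pM2l d0).
have := ricker_convex (lexx 2) z2 (ltW zw).
have := ler_wpM2l (_ : 0 <= w - z) sec2; rewrite subr_ge0 => /(_ (ltW zw)).
by lra.
Qed.

(** The case where the bound by 1 on secant slopes is too weak: for [y > e] the
    term [e/2] falls short of [y/2].  The shortfall is made up by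
    [ricker z - ricker y] when [z] is far from [y], and by the flatness of the
    secant otherwise. *)
Lemma ricker_secant_above_e v y z w : (1 - v) * expR (2 - v) = 1 ->
  16 / 33 * y <= z -> 16 / 33 * y <= w -> z <= y ->
  expR 1 < y -> ricker y <= ricker z -> exists2 k, 0 <= k &
    `|ricker z - ricker w| <= k * `|z - w| /\
    k * y <= 7 / 4 * (ricker z - ricker y) + y / 2 + expR 1 / 2.
Proof.
move=> hv yz yw zy ey gyz; have /andP[e1 _] := @expR1_bounds R.
case: (leP y (13 / 2)) => y2; last first.
  (* 16/33 bounds fl / r from below (floor_ge_ratio). *)
  pose s := 16 / 33 * y.
  have s2 : 3 + 3 / 20 <= s by rewrite /s; lra.
  have sl0 c : s <= c -> 0 <= ricker_slope c.
    by move=> sc; rewrite mulr_ge0 ?expR_ge0//; lra.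
  (* For y > 13/2 both end points lie beyond s > 3, where the slope is small. *)
  exists (ricker_slope s); first exact: sl0.
  split.
    apply: (ricker_lipschitz_on (m := s)) => // c sc.
    rewrite ger0_norm ?sl0// ricker_slope_nincr//; lra.
  have h := expR_ge_taylor3 (s - 3).
  have h2 : 27 / 10 * (1 + (s - 3) + (s - 3) ^+ 2 / 2) <= expR (s - 2).
    rewrite (_ : s - 2 = 1 + (s - 3)); last by ring.
    rewrite expRD; apply: ler_pM => //; first by rewrite addr_ge0 ?divr_ge0 ?sqr_ge0//; lra.
    apply: le_trans h; rewrite lerDl divr_ge0// exprn_ge0//; lra.
  have yE : y = 33 / 16 * s by rewrite /s; field.
  have sl : ricker_slope s * s <= s / 2 + 36 / 55.
    have eN : expR (2 - s) = (expR (s - 2))^-1 by rewrite -expRN opprB.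
    rewrite /ricker_slope eN mulrAC ler_pdivrMr ?expR_gt0//.
    have c0 : 0 <= s / 2 + 36 / 55 by lra.
    apply: (le_trans _ (ler_wpM2l c0 h2)).
    have : 0 <= (s - 3 - 3 / 20) * (s - 3) by rewrite mulr_ge0//; lra.
    have : 0 <= (s - 3) ^+ 3 by rewrite exprn_ge0//; lra.
    by lra.
  by rewrite yE in gyz *; lra.
case: (leP 2 z) => z2; last first.
  exists 1 => //; split.
    by apply: (ricker_lipschitz_on (m := v)) => [c|//|]; last first;
      have /andP[v0 v1] := varsigma_bounds hv; [lra|lra|exact: ricker_slope_norm_le1].
  have h := expR_ge1Dx (y - 2).
  have ge : ricker y <= 27 / 17.
    have eN : expR (2 - y) = (expR (y - 2))^-1 by rewrite -expRN opprB.
    by rewrite /ricker eN ler_pdivrMr ?expR_gt0//; lra.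
  have gz : 2 <= ricker z by rewrite -{1}ricker2; apply: ricker_nincr; lra.
  by lra.
have y1 : 27 / 10 <= y by lra.
have w1 : 1 <= w by lra.
have y0 : 0 < y by lra.
have := @ricker_secant_from y z w y1 y2 z2 zy w1.
set rho := 1 - _; have rhoE : rho * y = y - 27 / 10 - 7 / 2 * (ricker z - ricker y).
  by rewrite /rho mulrBl mul1r divfK ?gt_eqF//; ring.
move=> hrho; case: (leP 0 rho) => rho0.
  exists (1 - rho / 2); last by split; [exact: hrho|lra].
  rewrite subr_ge0 ler_pdivrMr// mul1r.
  by rewrite -(ler_pM2r y0) rhoE; lra.
exists 1 => //; split.
  by apply: (ricker_lipschitz_on (m := v)) => [c|//|]; last first;
      have /andP[v0 v1] := varsigma_bounds hv; [lra|lra|exact: ricker_slope_norm_le1].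
have : rho * y <= 0 by rewrite mulr_le0_ge0// ltW.
by rewrite rhoE; lra.
Qed.

Section Floor.
Variables v r fl : R.
Hypotheses (hv : (1 - v) * expR (2 - v) = 1) (r1 : 1 < r) (hfl : expR (v * (r - fl)) = r).

Lemma floor_depth_gt0 : 0 < r - fl.
Proof.
have /andP[v0 _] := varsigma_bounds hv.
rewrite -(pmulr_rgt0 _ (_ : 0 < v)); last by lra.
by rewrite -ltr_expR expR0 hfl.
Qed.

Lemma floor_depth_le k : r <= expR k -> 18 / 25 * (r - fl) <= k.
Proof.
move=> rk; have /andP[v0 _] := varsigma_bounds hv.
apply: (@le_trans _ _ (v * (r - fl))); last by rewrite -ler_expR hfl.
by rewrite ler_wpM2r// ltW// floor_depth_gt0.
Qed.

(** [fl / r = 1 - ln r / (v r)], and [ln r / r <= 1/e]. *)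
Lemma floor_ge_ratio : 16 / 33 * r <= fl.
Proof.
have /andP[e1 _] := @expR1_bounds R.
have h := expR_ge1Dx (r / expR 1 - 1).
have e0 := @expR_gt0 R 1.
have : r <= expR (r / expR 1).
  rewrite (_ : expR (r / expR 1) = expR (r / expR 1 - 1) * expR 1); last first.
    by rewrite -expRD; congr expR; ring.
  by rewrite -ler_pdivrMr//; lra.
move=> /floor_depth_le; rewrite ler_pdivlMr// => h2.
have h3 : 18 / 25 * (r - fl) * (27 / 10) <= 18 / 25 * (r - fl) * expR 1.
  rewrite ler_wpM2l// mulr_ge0 ?(ltW floor_depth_gt0)//; lra.
by have := r1; lra.
Qed.

(** The tangent of the logarithm at 8/5, with [ln (8/5) <= 8/17], bounds
    [fl = r - ln r / v] from below. *)
Lemma floor_ge_tangent : 19 / 144 * r + 25 / 34 <= fl.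
Proof.
have r1' := r1; have h := expR_ge1Dx (5 / 8 * r - 1).
have t := @expR_ge_taylor3 R (4 / 17).
have e8 : 8 / 5 <= expR (8 / 17) :> R.
  rewrite (_ : 8 / 17 = 4 / 17 + 4 / 17); last by field.
  rewrite expRD; apply: (@le_trans _ _ (105 / 83 * (105 / 83))); last first.
  apply: ler_pM => //; lra.
  by lra.
have : r <= expR (8 / 17 + (5 / 8 * r - 1)).
  rewrite expRD; apply: (@le_trans _ _ (8 / 5 * (1 + (5 / 8 * r - 1)))); first by lra.
  by apply: ler_pM => //; lra.
by move=> /floor_depth_le; lra.
Qed.

(** For values of [z] below the maximum of the Ricker map, the loss
    [ricker (a r) - ricker z] is at most [(1 - fl) e]; this inequality pays
    for it.  The margin is smallest near [r = 7/5], where [1 - fl] is largest. *)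
Lemma floor_weight_margin a : fl < 1 -> a * fl < 1 ->
  7 / 4 * (1 - fl) * expR 1 + a / 2 <= expR 1 / (2 * r).
Proof.
move=> fl1 amu; have r1' := r1; have lmu := floor_ge_tangent; have rmu := floor_ge_ratio.
have /andP[e1 _] := @expR1_bounds R.
have r2 : r <= 203 / 100 by lra.
have fl0 : 0 < fl by lra.
set l := 19 / 144 * r + 25 / 34 in lmu.
have key : r <= 27 / 10 * (fl * (1 - 7 / 2 * (1 - fl) * r)).
  apply: (@le_trans _ _ (27 / 10 * (l * (1 - 7 / 2 * (1 - l) * r)))).
    have : 0 <= (r - 27 / 20) ^+ 2 * (r + 27 / 10) by rewrite mulr_ge0 ?sqr_ge0//; lra.
    have := sqr_ge0 (r - 27 / 20).
    rewrite /l; lra.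
  suff : 0 <= (fl - l) * (1 - 7 / 2 * r + 7 / 2 * r * (fl + l)) by lra.
  rewrite mulr_ge0 ?subr_ge0//.
  have : 0 <= r * (fl - 25 / 34) by rewrite mulr_ge0//; rewrite /l in lmu; lra.
  have : 0 <= r * (l - 25 / 34) by rewrite mulr_ge0// /l; lra.
  by lra.
have s0 : 0 <= fl * (1 - 7 / 2 * (1 - fl) * r) by lra.
have key2 := ler_wpM2r s0 e1.
rewrite ler_pdivlMr; last by lra.
rewrite -(ler_pM2r fl0).
have : 0 <= r * (1 - a * fl) by rewrite mulr_ge0//; lra.
by lra.
Qed.

(** Here [a], [z], [w] and [a r] are [A1], [x], [y] and [A2] in units of
    [1 / alpha].  If [ricker z < ricker (a r)], or if [a r <= e], the right side
    is at least [a] and [ricker_secant_weight] suffices; otherwise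
    [ricker_secant_above_e] applies. *)
Lemma ricker_weighted_secant a z w : fl < 1 -> v <= a -> a * fl <= z -> z <= a * r ->
  a <= w -> w <= a * r ->
  `|ricker z - ricker w| / `|z - w| * Num.min a (a + 7 / 4 * (z - a)) <=
  7 / 4 * (ricker z - ricker (a * r)) + a / 2 + expR 1 / (2 * r).
Proof.
move=> fl1 va amz zar aw war.
have r1' := r1; have /andP[e1 _] := @expR1_bounds R.
have /andP[v0 v1] := varsigma_bounds hv.
have rmu := floor_ge_ratio.
set W := Num.min _ _; set L := `|ricker z - ricker w| / `|z - w|; set RHS := (X in _ <= X).
have r0 : 0 < r by lra.
have a0 : 0 < a by lra.
have fl0 : 0 < fl by lra.
have z0 : 0 <= z by apply: le_trans amz; rewrite mulr_ge0// ltW.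
have vw : v <= w by exact: le_trans aw.
have L0 : 0 <= L by rewrite divr_ge0.
have LWa : L * W <= a.
  rewrite /L; have [zw|zw] := eqVneq z w.
    by rewrite zw subrr normr0 mul0r mul0r ltW.
  rewrite mulrAC ler_pdivrMr ?normr_gt0 ?subr_eq0//.
  exact: (ricker_secant_weight hv va z0 vw).
have Wa : W <= a by rewrite ge_min lexx.
have trivial_case : a <= RHS -> L * W <= RHS by exact: le_trans.
have main k : 0 <= k -> `|ricker z - ricker w| <= k * `|z - w| -> k * a <= RHS -> L * W <= RHS.
  move=> k0 hk; apply: le_trans.
  have Lk : L <= k.
    rewrite /L; have [zw|zw] := eqVneq z w; first by rewrite zw subrr !normr0 mul0r.
    by rewrite ler_pdivrMr ?normr_gt0 ?subr_eq0.
  by apply: (le_trans (ler_wpM2l L0 Wa)); rewrite ler_wpM2r// ltW.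
clearbody L W.
have ar : a * r = r * a by rewrite mulrC.
case: (leP (ricker (a * r)) (ricker z)) => gyz; last first.
  have z1 : z < 1.
    by rewrite ltNge; apply/negP => z1; move: gyz; rewrite ltNge ricker_nincr.
  apply: trivial_case.
  have amu1 := le_lt_trans amz z1.
  have margin := floor_weight_margin fl1 amu1.
  have g1 : ricker (a * fl) <= ricker z by apply: ricker_ndecr => //; exact: ltW.
  have g2 : fl * ricker (a * r) <= ricker (a * fl).
    have hr : r <= expR (a * (r - fl)).
      by rewrite -{1}hfl ler_expR ler_wpM2r// ltW// floor_depth_gt0.
    have eD : expR (2 - a * fl) = expR (2 - a * r) * expR (a * (r - fl)).
      by rewrite -expRD; congr expR; ring.
    have E0 : 0 <= a * fl * expR (2 - a * r) by rewrite !mulr_ge0 ?expR_ge0 ?(ltW a0) ?(ltW fl0).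
    by rewrite /ricker eD; have := ler_wpM2l E0 hr; lra.
  have g3 := ricker_le_e (a * r).
  have : (1 - fl) * ricker (a * r) <= (1 - fl) * expR 1 by rewrite ler_wpM2l//; lra.
  by rewrite /RHS; lra.
case: (leP (a * r) (expR 1)) => ey.
  apply: trivial_case.
  suff : a / 2 <= expR 1 / (2 * r) by rewrite /RHS; lra.
  by rewrite ler_pdivlMr; lra.
have yz : 16 / 33 * (a * r) <= z.
  by apply: le_trans amz; rewrite mulrCA ler_pM2l.
have yw : 16 / 33 * (a * r) <= w.
  apply: le_trans aw; rewrite mulrCA -[leRHS]mulr1 ler_pM2l//; lra.
have [k k0 [hk hky]] := ricker_secant_above_e hv yz yw zar ey gyz.
apply: (main k) => //.
rewrite -(ler_pM2r r0) -mulrA; apply: (le_trans hky).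
have eE : expR 1 / (2 * r) * r = expR 1 / 2 by field; rewrite gt_eqF.
have -> : RHS * r = 7 / 4 * (ricker z - ricker (a * r)) * r + a / 2 * r + expR 1 / 2.
  by rewrite /RHS -eE; ring.
have : 0 <= 7 / 4 * (ricker z - ricker (a * r)) * (r - 1) by rewrite !mulr_ge0//; lra.
by lra.
Qed.

End Floor.

End RickerSecants.

(** * Delta derivatives and comparison on a time scale *)

Section TimeScales.
Set Implicit Arguments.
Unset Strict Implicit.
Context {R : realType}.
Implicit Types (S T : set R) (t s d e : R) (f g : R -> R).

Lemma closed_inf_mem S (B : set R) : closed S -> B `<=` S -> has_inf B -> S (inf B).
Proof.
move=> clS BS hB; rewrite [S](closure_id S).1//.
apply: (closure_subset BS) => U /nbhs_ballP[e /= e0 eU].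
have [b Bb be] := inf_adherent e0 hB; exists b; split => //; apply: eU.
rewrite /ball/= ler0_norm ?subr_le0; first by rewrite opprB ltrBlDl.
by apply: ge_inf => //; case: hB.
Qed.

Lemma sigma_le S t s : S s -> t < s -> sigma S t <= s.
Proof.
move=> Ss ts; rewrite /sigma; case: asboolP => [_|[]]; last by exists s.
by apply: ge_inf => //; exists t => u [_ /ltW].
Qed.

Lemma le_sigma S t : t <= sigma S t.
Proof.
rewrite /sigma; case: asboolP => [[s Ss ts]|//].
by apply: lb_le_inf; [exists s|move=> u [_ /ltW]].
Qed.

Lemma sigma_mem S t : closed S -> S t -> S (sigma S t).
Proof.
move=> clS St; rewrite /sigma; case: asboolP => [[s Ss ts]|//].
apply: closed_inf_mem clS _ _ => [u []//|].
by split; [exists s|exists t => u [_ /ltW]].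
Qed.

Lemma mu_ge0 S t : 0 <= mu S t.
Proof. by rewrite subr_ge0 le_sigma. Qed.

(** Restricting the time scale to [t >= t0] does not change the forward jump,
    so a solution on all of [T] also solves the initial value problem. *)
Lemma sigma_restrict T t0 t : t0 <= t -> sigma (T `&` [set u | t0 <= u]) t = sigma T t.
Proof.
move=> t0t; rewrite /sigma.
have -> : [set s | (T `&` [set u | t0 <= u]) s /\ t < s] = [set s | T s /\ t < s].
  apply/seteqP; split => u /= => [[[]]|[Tu tu]]//; split => //; split => //.
  exact: le_trans t0t (ltW tu).
congr (if _ then _ else _); apply: asbool_equiv_eq; split => -[s].
  by case=> Ts _ ts; exists s.
by move=> Ts ts; exists s => //; split => //=; exact: le_trans t0t (ltW ts).
Qed.

Lemma mu_restrict T t0 t : t0 <= t -> mu (T `&` [set u | t0 <= u]) t = mu T t.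
Proof. by move=> h; rewrite /mu sigma_restrict. Qed.

Lemma delta_derive_restrict T t0 f t d : t0 <= t -> is_delta_derive T f t d ->
  is_delta_derive (T `&` [set u | t0 <= u]) f t d.
Proof.
move=> t0t h e e0; have [del del0 hd] := h e e0; exists del => // s [Ts _] sd.
by rewrite sigma_restrict// hd.
Qed.

Lemma closed_restrict T t0 : closed T -> closed (T `&` [set u | t0 <= u]).
Proof.
move=> clT; apply: closedI => //.
Qed.

(** Taking [s = t] in the definition gives an error at most [eps * mu] for every
    [eps]. *)
Lemma delta_derive_sigma S f t d : S t -> is_delta_derive S f t d ->
  f (sigma S t) = f t + d * mu S t.
Proof.
move=> St h; apply/eqP; rewrite -subr_eq0 -normr_eq0; apply/eqP/le_anti.
rewrite normr_ge0 andbT; apply/ler_addgt0Pl => e e0; rewrite addr0.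
have m0 : 0 <= sigma S t - t by rewrite subr_ge0 le_sigma.
have m1 : 0 < sigma S t - t + 1 by lra.
have [del del0 hd] := h (e / (sigma S t - t + 1)) (divr_gt0 e0 m1).
have := hd t St; rewrite subrr normr0 => /(_ del0).
rewrite opprD addrA => /le_trans; apply.
rewrite (ger0_norm m0) mulrAC ler_pdivrMr// ler_wpM2l ?(ltW e0)//; lra.
Qed.

Lemma delta_derive_continuous S f t d : S t -> is_delta_derive S f t d ->
  forall e, 0 < e -> exists2 del, 0 < del &
    forall s, S s -> `|s - t| < del -> `|f s - f t| <= e.
Proof.
move=> St h e e0; have fs := delta_derive_sigma St h.
have m0 := mu_ge0 S t.
have k0 : 0 < mu S t + 1 by lra.
have [del1 del10 hd] := h (e / 2 / (mu S t + 1)) (divr_gt0 (divr_gt0 e0 (ltr0Sn R 1)) k0).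
have k1 : 0 < `|d| + 1 by rewrite ltr_wpDl.
pose del := Num.min del1 (Num.min 1 (e / 2 / (`|d| + 1))).
exists del; first by rewrite !lt_min del10 ltr01 !divr_gt0.
move=> s Ss; rewrite !lt_min => /and3P[s1 s2 s3].
have h1 := hd s Ss s1.
have -> : f s - f t = - (f (sigma S t) - f s - d * (sigma S t - s)) + d * (s - t).
  by rewrite fs /mu; ring.
apply: (le_trans (ler_normD _ _)); rewrite normrN normrM.
have : `|d| * `|s - t| <= e / 2.
  apply: (@le_trans _ _ ((`|d| + 1) * `|s - t|)); first by rewrite ler_wpM2r//; lra.
  by rewrite mulrC -ler_pdivlMr// ltW.
suff : `|f (sigma S t) - f s - d * (sigma S t - s)| <= e / 2 by lra.
apply: (le_trans h1); rewrite mulrAC ler_pdivrMr// ler_wpM2l//; first by lra.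
have -> : sigma S t - s = mu S t + (t - s) by rewrite /mu; ring.
apply: (le_trans (ler_normD _ _)); rewrite (ger0_norm m0) (distrC t).
by rewrite lerD2l ltW.
Qed.

Lemma delta_deriveD S f g t df dg : is_delta_derive S f t df -> is_delta_derive S g t dg ->
  is_delta_derive S (fun u => f u + g u) t (df + dg).
Proof.
move=> hf hg e e0; have e20 : 0 < e / 2 by rewrite divr_gt0.
have [d1 d10 h1] := hf _ e20; have [d2 d20 h2] := hg _ e20.
exists (Num.min d1 d2); first by rewrite lt_min d10.
move=> s Ss; rewrite lt_min => /andP[s1 s2].
have := lerD (h1 s Ss s1) (h2 s Ss s2); rewrite -mulrDl -splitr; apply: le_trans.
apply: le_trans (ler_normD _ _).
by rewrite le_eqVlt; apply/orP; left; apply/eqP; congr `|_|; ring.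
Qed.

Lemma delta_deriveZ S f t df k : is_delta_derive S f t df ->
  is_delta_derive S (fun u => k * f u) t (k * df).
Proof.
move=> hf e e0; have k0 : 0 < `|k| + 1 by rewrite ltr_wpDl.
have [d1 d10 h1] := hf _ (divr_gt0 e0 k0); exists d1 => // s Ss s1.
rewrite (_ : _ - _ - _ = k * (f (sigma S t) - f s - df * (sigma S t - s))); last by ring.
rewrite normrM; apply: (le_trans (ler_wpM2l (normr_ge0 _) (h1 s Ss s1))).
rewrite mulrA ler_wpM2r// mulrCA ger_pMr// ler_pdivrMr//; lra.
Qed.

Lemma delta_derive_cst S k t : is_delta_derive S (fun=> k) t 0.
Proof.
move=> e e0; exists 1 => // s _ _; rewrite subrr mul0r subr0 normr0.
by rewrite mulr_ge0// ltW.
Qed.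

Lemma delta_derive_id S t : is_delta_derive S id t 1.
Proof.
move=> e e0; exists 1 => // s _ _; rewrite mul1r subrr normr0.
by rewrite mulr_ge0// ltW.
Qed.

(** [f s g s] changes by [g(sigma) Df + f(s) Dg]; the product rule replaces
    [f s] by [f t], which costs [f s - f t] and uses continuity. *)
Lemma delta_deriveM S f g t df dg : S t ->
  is_delta_derive S f t df -> is_delta_derive S g t dg ->
  is_delta_derive S (fun u => f u * g u) t (df * g (sigma S t) + f t * dg).
Proof.
move=> St hf hg e e0.
pose G := `|g (sigma S t)| + 1; pose F := `|f t| + 1; pose D := `|dg| + 1.
have G0 : 0 < G by rewrite ltr_wpDl.
have F0 : 0 < F by rewrite ltr_wpDl.
have D0 : 0 < D by rewrite ltr_wpDl.
have e3 : 0 < e / 3 by rewrite divr_gt0.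
have [d1 d10 h1] := hf _ (divr_gt0 e3 G0).
have [d2 d20 h2] := hg _ (divr_gt0 e3 F0).
have c0 : 0 < Num.min 1 (e / 3 / D) by rewrite lt_min ltr01 divr_gt0.
have [d3 d30 h3] := delta_derive_continuous St hf c0.
exists (Num.min d1 (Num.min d2 d3)); first by rewrite !lt_min d10 d20.
move=> s Ss; rewrite !lt_min => /and3P[s1 s2 s3].
have {}h1 := h1 s Ss s1; have {}h2 := h2 s Ss s2.
have := h3 s Ss s3; rewrite le_min => /andP[h31 h32].
set a := sigma S t - s in h1 h2 *.
have -> : f (sigma S t) * g (sigma S t) - f s * g s - (df * g (sigma S t) + f t * dg) * a =
  g (sigma S t) * (f (sigma S t) - f s - df * a) + f s * (g (sigma S t) - g s - dg * a)
  + (f s - f t) * dg * a by ring.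
have fsF : `|f s| <= F.
  rewrite /F (_ : f s = f t + (f s - f t)); last by ring.
  by apply: (le_trans (ler_normD _ _)); rewrite lerD2l.
have gG : `|g (sigma S t)| <= G by rewrite /G lerDl.
have dD : `|dg| <= D by rewrite /D lerDl.
apply: (le_trans (ler_normD _ _)); apply: (le_trans (lerD (ler_normD _ _) (lexx _))).
rewrite !normrM.
have k1 : `|g (sigma S t)| * `|f (sigma S t) - f s - df * a| <= e / 3 * `|a|.
  apply: (le_trans (ler_pM _ _ gG h1)) => //.
  by rewrite mulrA mulrCA divff ?gt_eqF// mulr1.
have k2 : `|f s| * `|g (sigma S t) - g s - dg * a| <= e / 3 * `|a|.
  apply: (le_trans (ler_pM _ _ fsF h2)) => //.
  by rewrite mulrA mulrCA divff ?gt_eqF// mulr1.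
have k3 : `|f s - f t| * `|dg| * `|a| <= e / 3 * `|a|.
  rewrite ler_wpM2r//; apply: (le_trans (ler_pM _ _ h32 dD)) => //.
  by rewrite divfK ?gt_eqF.
by lra.
Qed.

Lemma sigma_next S a b : S b -> a < b -> (forall s, S s -> a < s -> b <= s) ->
  sigma S a = b.
Proof.
move=> Sb ab h; apply/le_anti; rewrite sigma_le//=.
rewrite /sigma; case: asboolP => [_|[]]; last by exists b.
by apply: lb_le_inf; [exists b|move=> s [Ss /h]; apply].
Qed.

(** A counterexample gives a first time [b] at which the property stops
    holding to the right; the three rules exclude that [b] is left-scattered
    and fails, left-dense and fails, or holds without a right extension. *)
Lemma time_scale_ind S t0 (P : R -> Prop) : closed S -> S t0 ->
  (forall s, S s -> t0 <= s) -> P t0 ->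
  (forall t, S t -> (forall s, S s -> s <= t -> P s) -> t < sigma S t -> P (sigma S t)) ->
  (forall t, S t -> (forall s, S s -> s <= t -> P s) -> sigma S t = t ->
     exists2 del, 0 < del & forall s, S s -> t < s < t + del -> P s) ->
  (forall t, S t -> (forall s, S s -> s < t -> P s) ->
     (forall del, 0 < del -> exists2 s, S s & t - del < s < t) -> P t) ->
  forall t, S t -> P t.
Proof.
move=> clS St0 mint0 P0 Pscat Pdense Pleft t1 St1; apply: contrapT => NP.
pose B := [set s | S s /\ ~ P s].
have hB : has_inf B.
  by split; [exists t1|exists t0 => s [Ss _]; exact: mint0].
pose b := inf B.
have Sb : S b by apply: closed_inf_mem clS _ hB => s [].
have below s : S s -> s < b -> P s.
  move=> Ss sb; apply: contrapT => NPs.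
  by move: sb; rewrite ltNge; apply/negP/negPn; apply: ge_inf => //; case: hB.
have Pb : P b.
  have [ld|nld] := pselect (forall del, 0 < del -> exists2 s, S s & b - del < s < b).
    exact: Pleft.
  have [del del0 hdel] : exists2 del, 0 < del & forall s, S s -> s < b -> s <= b - del.
    apply: contrapT => h; apply: nld => del del0; apply: contrapT => h2; apply: h.
    exists del => // s Ss sb; rewrite leNgt; apply/negP => bs; apply: h2.
    by exists s => //; rewrite bs.
  have [->//|bt0] := eqVneq b t0.
  have t0b : t0 < b by rewrite lt_neqAle eq_sym bt0 mint0.
  pose A := [set s | S s /\ s < b].
  have A0 : A !=set0 by exists t0.
  have ubA : ubound A (b - del) by move=> s [Ss sb]; exact: hdel.
  pose a := sup A.
  have Sa : S a.
    rewrite [S](closure_id S).1//; apply: (@closure_subset _ A) => [s []//|].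
    by apply: closure_sup => //; exists (b - del).
  have ab : a < b by apply: (@le_lt_trans _ _ (b - del)); [exact: ge_sup|lra].
  have sa : sigma S a = b.
    apply: sigma_next => // s Ss as_; rewrite leNgt; apply/negP => sb.
    move: as_; rewrite ltNge; apply/negP/negPn; apply: ub_le_sup; first by exists (b - del).
    by [].
  rewrite -sa; apply: Pscat => //; last by rewrite sa.
  by move=> s Ss sle; apply: below => //; exact: le_lt_trans ab.
have upto s : S s -> s <= b -> P s.
  by move=> Ss; rewrite le_eqVlt => /predU1P[->//|]; exact: below.
have near_b e : 0 < e -> exists2 s, B s & b < s < b + e.
  move=> e0; have [s Bs se] := inf_adherent e0 hB; exists s => //; rewrite se andbT.
  rewrite lt_neqAle; apply/andP; split; last by apply: ge_inf => //; case: hB.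
  by apply/eqP => bs; case: Bs => _; rewrite -bs.
have := le_sigma S b; rewrite le_eqVlt => /predU1P[sb|sb].
  have [del del0 hd] := Pdense b Sb upto (esym sb).
  by have [s [Ss NPs] bs] := near_b _ del0; apply: NPs; exact: hd.
have [|s [Ss NPs] /andP[bs sbe]] := near_b (sigma S b - b); first by rewrite subr_gt0.
have := sigma_le Ss bs; lra.
Qed.

(** The reciprocal of one plus the sum of the reciprocals works. *)
Lemma fin_pos_lower_bound (K : finType) (F : K -> R) : (forall k, 0 < F k) ->
  exists2 m, 0 < m & forall k, m <= F k.
Proof.
move=> F0; have s0 : 0 <= \sum_k (F k)^-1 by apply: sumr_ge0 => k _; rewrite invr_ge0 ltW.
exists (1 + \sum_k (F k)^-1)^-1; first by rewrite invr_gt0 ltr_pwDl.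
move=> k; rewrite -[leRHS]invrK lef_pV2 ?posrE ?invr_gt0 ?ltr_pwDl//.
rewrite (bigD1 k)//= addrCA lerDl addr_ge0//.
by apply: sumr_ge0 => l _; rewrite invr_ge0 ltW.
Qed.

(** Across a jump, [u + mu D = (1 - mu c) u + mu (D + c u)] is nonnegative.  At
    a right-dense zero of [u] the hypothesis reads [D > 0], so [u] increases.
    Strictness of [D + c u > 0] is what handles the zeros. *)
Lemma barrier S t0 (K : finType) (u D c : K -> R -> R) : closed S -> S t0 ->
  (forall s, S s -> t0 <= s) ->
  (forall k t, S t -> is_delta_derive S (u k) t (D k t)) ->
  (forall k t, S t -> 0 <= 1 - mu S t * c k t) ->
  (forall k, 0 <= u k t0) ->
  (forall t k, S t -> (forall s l, S s -> s <= t -> 0 <= u l s) ->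
     0 < D k t + c k t * u k t) ->
  forall t k, S t -> 0 <= u k t.
Proof.
move=> clS St0 mint0 du c1 u0 Dpos t k St; move: t St k.
apply: (@time_scale_ind S t0) => //.
- move=> t St upto _ k; rewrite (delta_derive_sigma St (du k t St)).
  have h := Dpos t k St (fun s l Ss st => upto s Ss st l).
  have p1 := mulr_ge0 (c1 k t St) (upto t St (lexx _) k).
  have p2 := mulr_ge0 (mu_ge0 S t) (ltW h).
  by lra.
- move=> t St upto sig.
  have right k : exists2 del, 0 < del & forall s, S s -> t < s < t + del -> 0 <= u k s.
    have h := Dpos t k St (fun s l Ss st => upto s Ss st l).
    have := upto t St (lexx _) k; rewrite le_eqVlt => /predU1P[ut|ut].
      have D0 : 0 < D k t by move: h; rewrite -ut mulr0 addr0.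
      have [del del0 hd] := du k t St (D k t) D0.
      exists del => // s Ss /andP[ts sd].
      have := hd s Ss; rewrite gtr0_norm ?subr_gt0// => /(_ ltac:(lra)).
      rewrite sig -ut sub0r (distrC t s) (gtr0_norm (_ : 0 < s - t)) ?subr_gt0//.
      by rewrite ler_norml => /andP[]; lra.
    have [del del0 hd] := delta_derive_continuous St (du k t St) ut.
    exists del => // s Ss /andP[ts sd].
    have := hd s Ss; rewrite gtr0_norm ?subr_gt0// => /(_ ltac:(lra)).
    by rewrite ler_norml => /andP[]; lra.
  pose del k := s2val (cid2 (right k)).
  have [m m0 mdel] : exists2 m, 0 < m & forall k, m <= del k.
    by apply: fin_pos_lower_bound => k; rewrite /del; case: cid2.
  exists m => // s Ss /andP[ts sm] k; have := mdel k; rewrite /del; case: cid2 => /= d _ hd md.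
  by apply: hd => //; rewrite ts/=; exact: lt_le_trans (lerD (lexx t) md).
- move=> t St below ld k; rewrite leNgt; apply/negP => ut.
  have e0 : 0 < - u k t / 2 by rewrite divr_gt0// oppr_gt0.
  have [del del0 hd] := delta_derive_continuous St (du k t St) e0.
  have [s Ss /andP[s1 s2]] := ld _ del0.
  have := hd s Ss; rewrite ltr0_norm ?subr_lt0// => /(_ ltac:(lra)).
  have := below s Ss s2 k; rewrite ler_norml; lra.
Qed.

End TimeScales.

(** * The exponential with a negative rate *)

Section Exponential.
Set Implicit Arguments.
Unset Strict Implicit.
Context {R : realType}.
Implicit Types (S T : set R) (t s u v e lam : R) (f g : R -> R).

(** The values at [t] of the exponentials, started at [s], of the finite time
    scales formed by chains in [T]; refining the chain decreases the value. *)
Inductive step_product T lam : R -> R -> R -> Prop :=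
| step_nil s : step_product T lam s s 1
| step_snoc s t u v : step_product T lam s t v -> T u -> t <= u ->
    step_product T lam s u (v / (1 + lam * (u - t))).

Lemma step_product_le T lam s t v : step_product T lam s t v -> s <= t.
Proof. by elim=> // {}s {}t u {}v _ st _; exact: le_trans. Qed.

Lemma step_product_mem T lam s t v : step_product T lam s t v -> T s -> T t.
Proof. by case. Qed.

Lemma step_gt0 lam t u : 0 < lam -> t <= u -> 0 < 1 + lam * (u - t).
Proof. by move=> l0 tu; rewrite ltr_wpDr// mulr_ge0 ?subr_ge0// ltW. Qed.

Lemma step_product_lower T lam s t v : 0 < lam -> step_product T lam s t v ->
  expR (- (lam * (t - s))) <= v.
Proof.
move=> l0; elim=> [{}s|{}s {}t u {}v _ IH _ tu].
  by rewrite subrr mulr0 oppr0 expR0.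
have -> : - (lam * (u - s)) = - (lam * (t - s)) + - (lam * (u - t)) by ring.
rewrite expRD [expR (- (lam * (u - t)))]expRN; apply: ler_pM => //; rewrite ?expR_ge0//.
by rewrite lef_pV2 ?posrE ?expR_gt0 ?step_gt0// expR_ge1Dx.
Qed.

Lemma step_product_gt0 T lam s t v : 0 < lam -> step_product T lam s t v -> 0 < v.
Proof. by move=> l0 /(step_product_lower l0); apply: lt_le_trans; exact: expR_gt0. Qed.

Lemma step_product_cat T lam s t u v w : step_product T lam s t v ->
  step_product T lam t u w -> step_product T lam s u (v * w).
Proof.
move=> hv hw; elim: hw v hv => [{}t|{}t u' {}u {}w _ IH Tu u'u] v hv.
  by rewrite mulr1.
by rewrite mulrA; apply: step_snoc => //; exact: IH.
Qed.

(** Inserting a point in a chain only decreases the product. *)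
Lemma step_product_split T lam s u v t : 0 < lam -> step_product T lam s u v ->
  T t -> s <= t -> t <= u ->
  exists v1 v2, [/\ step_product T lam s t v1, step_product T lam t u v2 & v1 * v2 <= v].
Proof.
move=> l0 + Tt; elim=> [{}s st ts|{}s u' {}u {}v hv IH Tu u'u st tu].
  have -> : t = s by apply/le_anti; rewrite ts.
  by exists 1, 1; rewrite mulr1; split => //; exact: step_nil.
case: (leP t u') => [tu'|u't].
  have [v1 [v2 [h1 h2 h12]]] := IH st tu'.
  exists v1, (v2 / (1 + lam * (u - u'))); split => //; first exact: step_snoc.
  by rewrite mulrA ler_wpM2r// invr_ge0 ltW// step_gt0.
exists (v / (1 + lam * (t - u'))), (1 / (1 + lam * (u - t))); split.
- by apply: step_snoc => //; exact: ltW.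
- by apply: step_snoc => //; exact: step_nil.
have v0 := step_product_gt0 l0 hv.
have a0 := step_gt0 l0 (ltW u't); have b0 := step_gt0 l0 tu.
rewrite mul1r -mulrA ler_wpM2l ?(ltW v0)// -invfM lef_pV2 ?posrE ?mulr_gt0 ?step_gt0 ?(le_trans (ltW u't))//.
have : 0 <= lam * (t - u') * (lam * (u - t)).
  by rewrite !mulr_ge0 ?(ltW l0)// subr_ge0// ltW.
by lra.
Qed.

Definition step_inf T lam s t : R := inf [set v | step_product T lam s t v].

Lemma step_inf_has_inf T lam s t : 0 < lam -> T t -> s <= t ->
  has_inf [set v | step_product T lam s t v].
Proof.
move=> l0 Tt st; split.
  by exists (1 / (1 + lam * (t - s))); apply: step_snoc => //; exact: step_nil.
by exists 0 => v /(step_product_gt0 l0)/ltW.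
Qed.

Lemma step_inf_le T lam s t v : 0 < lam -> step_product T lam s t v ->
  step_inf T lam s t <= v.
Proof.
by move=> l0 hv; apply: ge_inf => //; exists 0 => w /(step_product_gt0 l0)/ltW.
Qed.

Lemma step_inf_lower T lam s t : 0 < lam -> T t -> s <= t ->
  expR (- (lam * (t - s))) <= step_inf T lam s t.
Proof.
move=> l0 Tt st; apply: lb_le_inf; first by case: (step_inf_has_inf l0 Tt st).
by move=> v; exact: step_product_lower.
Qed.

Lemma step_inf_gt0 T lam s t : 0 < lam -> T t -> s <= t -> 0 < step_inf T lam s t.
Proof. by move=> l0 Tt st; apply: lt_le_trans (step_inf_lower l0 Tt st); exact: expR_gt0. Qed.

Lemma step_inf_upper T lam s t : 0 < lam -> T t -> s <= t ->
  step_inf T lam s t <= (1 + lam * (t - s))^-1.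
Proof.
move=> l0 Tt st; rewrite -[leRHS]mul1r; apply: step_inf_le => //.
by apply: step_snoc => //; exact: step_nil.
Qed.

Lemma step_infxx T lam s : 0 < lam -> T s -> step_inf T lam s s = 1.
Proof.
move=> l0 Ts; apply/le_anti.
have := step_inf_lower l0 Ts (lexx s); have := step_inf_upper l0 Ts (lexx s).
by rewrite subrr mulr0 addr0 invr1 oppr0 expR0 => -> ->.
Qed.

(** Concatenation of chains gives one inequality and insertion of [t] in a
    chain the other. *)
Lemma step_infM T lam s t u : 0 < lam -> T t -> T u -> s <= t -> t <= u ->
  step_inf T lam s u = step_inf T lam s t * step_inf T lam t u.
Proof.
move=> l0 Tt Tu st tu; have su := le_trans st tu.
have E1 := step_inf_gt0 l0 Tt st; have E2 := step_inf_gt0 l0 Tu tu.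
apply/le_anti/andP; split.
  rewrite -ler_pdivrMr//; apply: lb_le_inf; first by case: (step_inf_has_inf l0 Tt st).
  move=> v hv; have v0 := step_product_gt0 l0 hv.
  rewrite ler_pdivrMr// mulrC -ler_pdivrMr//; apply: lb_le_inf.
    by case: (step_inf_has_inf l0 Tu tu).
  move=> w hw; rewrite ler_pdivrMr// mulrC; apply: step_inf_le => //.
  exact: step_product_cat hv hw.
apply: lb_le_inf; first by case: (step_inf_has_inf l0 Tu su).
move=> v hv; have [v1 [v2 [h1 h2 h12]]] := step_product_split l0 hv Tt st tu.
apply: le_trans h12; apply: ler_pM; rewrite ?(ltW E1) ?(ltW E2)//; exact: step_inf_le.
Qed.

(** A chain from [t] to [sigma t] has no intermediate point. *)
Lemma step_inf_sigma T lam t : 0 < lam -> closed T -> T t ->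
  step_inf T lam t (sigma T t) = (1 + lam * mu T t)^-1.
Proof.
move=> l0 clT Tt; have Ts := sigma_mem clT Tt; have ts := le_sigma T t.
apply/le_anti; rewrite step_inf_upper//=.
apply: lb_le_inf; first by case: (step_inf_has_inf l0 Ts ts).
have gen s u v : step_product T lam s u v -> s = t -> u <= sigma T t ->
    (1 + lam * (u - t))^-1 <= v.
  elim=> [{}s -> _|{}s u' {}u {}v hv IH Tu u'u sE us].
    by rewrite subrr mulr0 addr0 invr1.
  have {}IH := IH sE (le_trans u'u us); subst s.
  have := step_product_le hv; rewrite le_eqVlt => /predU1P[tu'|tu'].
    rewrite -tu' in IH u'u *; rewrite subrr mulr0 addr0 invr1 in IH.
    by rewrite -[leLHS]mul1r ler_wpM2r// invr_ge0 ltW// step_gt0.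
  have u's : u' = sigma T t.
    apply/le_anti; rewrite (le_trans u'u us)/= sigma_le//.
    exact: step_product_mem hv Tt.
  have uE : u = u' by apply/le_anti; rewrite u'u u's us.
  by rewrite uE subrr mulr0 addr0 divr1.
by move=> v hv; exact: gen hv erefl (lexx _).
Qed.

(** The exponential with rate [ominus lam]: before [t0] it is the inverse of the
    infimum, so that [decayM] holds on both sides of [t0]. *)
Definition decay T lam t0 t : R :=
  if t0 <= t then step_inf T lam t0 t else (step_inf T lam t t0)^-1.

Section Decay.
Variables (T : set R) (lam t0 : R).
Hypotheses (clT : closed T) (l0 : 0 < lam) (Tt0 : T t0).

Lemma decayM s t : T s -> T t -> s <= t ->
  decay T lam t0 t = decay T lam t0 s * step_inf T lam s t.
Proof.
move=> Ts Tt st; rewrite /decay; case: (leP t0 s) => t0s.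
  by rewrite (le_trans t0s st) (step_infM l0 Ts Tt).
case: (leP t0 t) => t0t.
  by rewrite (step_infM l0 Tt0 Tt (ltW t0s) t0t) mulKf// gt_eqF// step_inf_gt0// ltW.
rewrite (step_infM l0 Tt Tt0 st (ltW t0t)) invfM mulrAC mulVf ?mul1r// gt_eqF// step_inf_gt0// ltW.
Qed.

Lemma decay0 : decay T lam t0 t0 = 1.
Proof. by rewrite /decay lexx step_infxx. Qed.

Lemma decay_gt0 t : T t -> 0 < decay T lam t0 t.
Proof.
move=> Tt; rewrite /decay; case: (leP t0 t) => h; first exact: step_inf_gt0.
by rewrite invr_gt0 step_inf_gt0// ltW.
Qed.

(** Both bounds [e^(- lam h) <= step_inf <= 1 / (1 + lam h)] agree with
    [1 - lam h] up to second order. *)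
Lemma decay_expansion t s : T t -> T s -> lam * `|s - t| <= 1 / 2 ->
  `|decay T lam t0 t * (1 - lam * (s - t)) - decay T lam t0 s| <=
  2 * decay T lam t0 t * (lam * `|s - t|) ^+ 2.
Proof.
move=> Tt Ts; have y0 := decay_gt0 Tt; set y := decay T lam t0 t in y0 *.
case: (leP t s) => st.
  rewrite ger0_norm ?subr_ge0// (decayM Tt Ts st) -/y.
  set x := lam * (s - t) => x2; have x0 : 0 <= x by rewrite mulr_ge0 ?(ltW l0)// subr_ge0.
  have h1 := step_inf_lower l0 Ts st; have h2 := step_inf_upper l0 Ts st.
  have h3 := expR_ge1Dx (- x).
  have h4 : (1 + x)^-1 <= 1 - x + 2 * x ^+ 2.
    rewrite -[leLHS]mul1r ler_pdivrMr; last by lra.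
    by have := sqr_ge0 x; have := exprn_ge0 3 x0; lra.
  rewrite -mulrBr normrM gtr0_norm// -mulrA mulrCA ler_pM2l// ler_norml.
  by have := sqr_ge0 x; move: h1 h2; rewrite -/x; lra.
rewrite ltr0_norm ?subr_lt0// opprB.
have -> : 1 - lam * (s - t) = 1 + lam * (t - s) by ring.
set x := lam * (t - s) => x2; have x0 : 0 <= x by rewrite mulr_ge0 ?(ltW l0)// subr_ge0 ltW.
have E0 := step_inf_gt0 l0 Tt (ltW st).
have h1 := step_inf_lower l0 Tt (ltW st); have h2 := step_inf_upper l0 Tt (ltW st).
have -> : decay T lam t0 s = y * (step_inf T lam s t)^-1.
  by rewrite /y (decayM Ts Tt (ltW st)) mulfK// gt_eqF.
set E := step_inf T lam s t in E0 h1 h2 *.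
have h3 : 1 - x <= E by apply: le_trans h1; exact: expR_ge1Dx.
have h4 : 1 + x <= E^-1.
  by rewrite -[leLHS]invrK lef_pV2 ?posrE ?invr_gt0//; rewrite /x in x0 *; lra.
have h5 : E^-1 <= 1 + x + 2 * x ^+ 2.
  rewrite -[leLHS]mul1r ler_pdivrMr//.
  have k0 : 0 <= 1 + x + 2 * x ^+ 2 by have := sqr_ge0 x; lra.
  apply: (le_trans _ (ler_wpM2l k0 h3)).
  have : 0 <= x ^+ 2 * (1 - 2 * x) by rewrite mulr_ge0 ?sqr_ge0//; lra.
  by lra.
rewrite -mulrBr normrM gtr0_norm// -mulrA mulrCA ler_pM2l// ler_norml.
by have := sqr_ge0 x; lra.
Qed.

(** With [m] the graininess at [t], the second order term of [decay_expansion]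
    and the difference [lam + ominus lam = lam^2 m / (1 + m lam)] give an error
    of order [h (2 h + m)] with [h = |s - t|], and [2 h + m] is at most
    [4 |sigma t - s|] for small [h]. *)
Lemma decay_derive t : T t ->
  is_delta_derive T (decay T lam t0) t (ominus T lam t * decay T lam t0 t).
Proof.
move=> Tt e e0; have y0 := decay_gt0 Tt; set y := decay T lam t0 t in y0 *.
have m0 := mu_ge0 T t; set m := mu T t in m0.
have q0 : 0 < 1 + m * lam by rewrite ltr_wpDr// mulr_ge0// ltW.
have sE : decay T lam t0 (sigma T t) = y + ominus T lam t * y * m.
  rewrite (decayM Tt (sigma_mem clT Tt) (le_sigma T t)) step_inf_sigma// -/y -/m.
  rewrite /ominus -/m; field.
  by rewrite ?(mulrC lam m) gt_eqF.
have L0 : 0 < 4 * lam ^+ 2 * y by rewrite !mulr_gt0 ?exprn_gt0.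
(* At a right-scattered point s must stay closer to t than half the jump. *)
pose h0 := if m == 0 then 1 else m / 2.
have h00 : 0 < h0.
  by rewrite /h0; case: eqVneq => // mn; rewrite divr_gt0// lt_neqAle eq_sym mn.
exists (Num.min h0 (Num.min (1 / 2 / lam) (e / (4 * lam ^+ 2 * y)))).
  by rewrite !lt_min h00 !divr_gt0.
move=> s Ts; rewrite !lt_min => /and3P[sh sl se].
have sl' : lam * `|s - t| <= 1 / 2 by rewrite mulrC -ler_pdivlMr// ltW.
have se' : `|s - t| * (4 * lam ^+ 2 * y) <= e by rewrite -ler_pdivlMr// ltW.
have := decay_expansion Tt Ts sl'; rewrite -/y.
set Q := _ - decay T lam t0 s => hQ.
have -> : decay T lam t0 (sigma T t) - decay T lam t0 s -
    ominus T lam t * y * (sigma T t - s) = Q + (lam + ominus T lam t) * y * (s - t).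
  by rewrite sE /Q /m /mu; ring.
have k0 : lam + ominus T lam t = lam ^+ 2 * m / (1 + m * lam).
  by rewrite /ominus -/m; field; rewrite gt_eqF.
have kle : `|lam + ominus T lam t| <= lam ^+ 2 * m.
  rewrite k0 ger0_norm; last by rewrite divr_ge0 ?(ltW q0)// mulr_ge0 ?sqr_ge0.
  have a0 : 0 <= lam ^+ 2 * m by rewrite mulr_ge0 ?sqr_ge0.
  rewrite ler_pdivrMr//; have := mulr_ge0 a0 (mulr_ge0 m0 (ltW l0)); lra.
apply: (le_trans (ler_normD _ _)).
set h := `|s - t| in sh sl' se' hQ *; have hh : 0 <= h by rewrite normr_ge0.
have bound : `|(lam + ominus T lam t) * y * (s - t)| <= lam ^+ 2 * m * y * h.
  by rewrite !normrM (gtr0_norm y0) -/h ler_wpM2r// ler_wpM2r// ltW.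
apply: (le_trans (lerD hQ bound)).
have -> : 2 * y * (lam * h) ^+ 2 + lam ^+ 2 * m * y * h = lam ^+ 2 * y * h * (2 * h + m) by ring.
have g : (2 * h + m) / 4 <= `|sigma T t - s|.
  have -> : sigma T t - s = m - (s - t) by rewrite /m /mu; ring.
  have [mz|mn] := eqVneq m 0.
    rewrite mz sub0r normrN -/h; lra.
  move: sh; rewrite /h0 (negbTE mn) => sh.
  have := lerB_dist m (s - t); rewrite (ger0_norm m0) -/h; lra.
apply: (@le_trans _ _ (e * ((2 * h + m) / 4))); last by rewrite ler_wpM2l// ltW.
have : 0 <= (e - h * (4 * lam ^+ 2 * y)) * (2 * h + m).
  by rewrite mulr_ge0 ?subr_ge0//; lra.
by lra.
Qed.

Lemma decay_ivp : exp_ivp T (ominus T lam) t0 (decay T lam t0).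
Proof. by split=> [t Tt|]; [exact: decay_derive|exact: decay0]. Qed.

Lemma ominus_lt0 t : ominus T lam t < 0.
Proof.
have q0 : 0 < 1 + mu T t * lam by rewrite ltr_wpDr// mulr_ge0 ?mu_ge0// ltW.
by rewrite /ominus mulNr oppr_lt0 divr_gt0.
Qed.

Lemma ominus_gt t : - lam <= ominus T lam t.
Proof.
have q0 : 0 < 1 + mu T t * lam by rewrite ltr_wpDr// mulr_ge0 ?mu_ge0// ltW.
rewrite /ominus mulNr lerN2 ler_pdivrMr// ler_peMr ?(ltW l0)//.
by rewrite lerDl mulr_ge0 ?mu_ge0// ltW.
Qed.

Lemma ominus_regressive t : 1 + mu T t * ominus T lam t = (1 + mu T t * lam)^-1.
Proof.
have q0 : 0 < 1 + mu T t * lam by rewrite ltr_wpDr// mulr_ge0 ?mu_ge0// ltW.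
by rewrite /ominus; field; rewrite gt_eqF.
Qed.

(** The difference of two solutions satisfies [u^Delta = ominus lam * u]; adding
    [eps (1 + t - t0)] makes the inequality of [barrier] strict. *)
Lemma decay_le_ts_exp t : T t -> t0 <= t ->
  decay T lam t0 t <= ts_exp T (ominus T lam) t t0.
Proof.
move=> Tt t0t; rewrite /ts_exp.
have ex : exists y, [set y | exp_ivp T (ominus T lam) t0 y] y.
  by exists (decay T lam t0); exact: decay_ivp.
have [dy y0] := xgetPex (fun=> 0) ex.
set y := xget _ _ in dy y0 *; clearbody y.
have k0 : 0 < 1 + (t - t0) by rewrite ltr_pwDl// subr_ge0.
suff bd e : 0 < e -> decay T lam t0 t - y t <= e * (1 + (t - t0)).
  apply/ler_addgt0Pl => e e0.
  by have := bd (e / (1 + (t - t0))) (divr_gt0 e0 k0); rewrite divfK ?gt_eqF//; lra.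
move=> e0.
pose S := T `&` [set u | t0 <= u].
pose u (_ : unit) v := y v + (-1 * decay T lam t0 v + (e * v + e * (1 - t0))).
pose p := ominus T lam.
pose D (_ : unit) v := p v * y v + (-1 * (p v * decay T lam t0 v) + (e * 1 + 0)).
pose c (_ : unit) v := - p v.
suff : 0 <= u tt t by rewrite /u; lra.
apply: (@barrier R S t0 unit u D c) => //.
- exact: closed_restrict.
- by split => /=.
- by move=> s [].
- move=> k v [Tv /= t0v]; apply: delta_derive_restrict => //.
  apply: delta_deriveD; first exact: dy.
  apply: delta_deriveD; first by apply: delta_deriveZ; exact: decay_derive.
  apply: delta_deriveD; last exact: delta_derive_cst.
  by apply: delta_deriveZ; exact: delta_derive_id.
- move=> k v [Tv /= t0v]; rewrite mu_restrict// /c mulrN opprK ominus_regressive.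
  by rewrite invr_ge0 ltW// ltr_wpDr// mulr_ge0 ?mu_ge0// ltW.
- by move=> k; rewrite /u y0 decay0//; lra.
move=> v k [Tv /= t0v] _; rewrite /D /u /c.
have pv := ominus_lt0 v; rewrite -/p in pv.
have : 0 <= (- p v) * (e * (1 + (v - t0))).
  by rewrite mulr_ge0 ?oppr_ge0 ?(ltW pv)// mulr_ge0 ?(ltW e0)//; lra.
by lra.
Qed.

End Decay.

(** Near a dense point the graininess is small, so that [ominus lam] is close
    to [- lam]. *)
Lemma ominus_dist T lam t : 0 < lam -> `|- lam - ominus T lam t| <= lam ^+ 2 * mu T t.
Proof.
move=> l0; have m0 := mu_ge0 T t.
have q0 : 0 < 1 + mu T t * lam by rewrite ltr_wpDr// mulr_ge0// ltW.
have -> : - lam - ominus T lam t = - (lam ^+ 2 * mu T t / (1 + mu T t * lam)).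
  by rewrite /ominus; field; rewrite gt_eqF.
rewrite normrN ger0_norm; last by rewrite divr_ge0 ?(ltW q0)// mulr_ge0 ?sqr_ge0.
have a0 : 0 <= lam ^+ 2 * mu T t by rewrite mulr_ge0 ?sqr_ge0.
rewrite ler_pdivrMr//; have := mulr_ge0 a0 (mulr_ge0 m0 (ltW l0)); lra.
Qed.

Lemma ominus_positively_regressive T lam : closed T -> 0 < lam ->
  positively_regressive T (ominus T lam).
Proof.
move=> clT l0; have L0 : 0 < lam ^+ 2 by rewrite exprn_gt0.
split; last first.
  move=> t Tt; rewrite ominus_regressive// invr_gt0 ltr_wpDr// mulr_ge0 ?mu_ge0//.
  exact: ltW.
split => t Tt.
  move=> [[s0 Ts0 ts0] st].
  have -> : ominus T lam t = - lam by rewrite /ominus /mu st subrr mul0r addr0 divr1.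
  apply/cvgrPdist_le => e e0.
  have d0 : 0 < e / lam ^+ 2 / 2 by rewrite !divr_gt0.
  have [u Tu /andP[tu ud]] : exists2 u, T u & t < u < t + e / lam ^+ 2 / 2.
    have hi : has_inf [set s | T s /\ t < s].
      by split; [exists s0|exists t => s [_ /ltW]].
    have [u [Tu tu] ud] := inf_adherent d0 hi; exists u => //; rewrite tu/=.
    move: ud; suff -> : inf [set s | T s /\ t < s] = t by [].
    by rewrite -[RHS]st /sigma; case: asboolP => // -[]; exists s0.
  have ut0 : 0 < u - t by rewrite subr_gt0.
  rewrite near_withinE; near=> s => Ts.
  apply: (le_trans (ominus_dist T s l0)); rewrite mulrC -ler_pdivlMr//.
  have sd : `|t - s| < e / lam ^+ 2 / 2.
    near: s; exact: (@cvgr_dist_lt _ _ _ (nbhs t)).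
  have su : `|t - s| < u - t.
    near: s; exact: (@cvgr_dist_lt _ _ _ (nbhs t)).
  move: sd su; rewrite !ltr_norml => /andP[sd1 sd2] /andP[su1 su2].
  have : sigma T s <= u by apply: sigma_le => //; lra.
  rewrite /mu; lra.
move=> _; apply/cvg_ex; exists (- lam); apply/cvgrPdist_le => e e0.
have d0 : 0 < e / lam ^+ 2 by rewrite !divr_gt0.
rewrite near_withinE; near=> s => Ts.
apply: (le_trans (ominus_dist T s l0)); rewrite mulrC -ler_pdivlMr//.
have st : s < t by near: s; exact: nbhs_left_lt.
have sd : t - e / lam ^+ 2 < s by near: s; apply: nbhs_left_gt; lra.
have := sigma_le Tt st; rewrite /mu; lra.
Unshelve. all: by end_near.
Qed.

End Exponential.

(** * Secants of the production term *)

Section Nicholson.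
Set Implicit Arguments.
Unset Strict Implicit.
Context {R : realType}.
Implicit Types x y z w a v r fl q A : R.

Definition production a x : R := x * expR (- a * x).
Definition secant a x y : R := `|production a x - production a y| / `|x - y|.
(** The deviation allowed at a point where the solution has the value [x];
    smaller below [A], where the production is steeper. *)
Definition weight A q x : R := Num.min A (A + q * (x - A)).

Lemma production_ricker a x : 0 < a -> ricker (a * x) = expR 2 * a * production a x.
Proof.
move=> a0; rewrite /ricker /production.
have -> : expR (2 - a * x) = expR 2 * expR (- a * x) by rewrite -expRD; congr expR; ring.
by ring.
Qed.

Lemma production_le a x : 0 < a -> production a x <= (a * expR 1)^-1.
Proof.
move=> a0; have := ricker_le_e (a * x); rewrite production_ricker//.
have e0 := @expR_gt0 R 1.
have -> : expR 2 = expR 1 * expR 1 :> R by rewrite -expRD; congr expR; ring.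
move=> h; rewrite -[leRHS]mul1r ler_pdivlMr ?mulr_gt0//.
rewrite -(ler_pM2l e0); lra.
Qed.

Lemma production_ge0 a x : 0 <= x -> 0 <= production a x.
Proof. by move=> x0; rewrite mulr_ge0// expR_ge0. Qed.

Lemma production_antitone a (a' : R) x : 0 <= x -> a <= a' -> production a' x <= production a x.
Proof.
by move=> x0 aa; rewrite ler_wpM2l// ler_expR !mulNr lerN2 ler_wpM2r.
Qed.

Lemma secant_ge0 a x y : 0 <= secant a x y.
Proof. by rewrite divr_ge0. Qed.

(** Division by zero yields the secant slope 0 when [x = y]. *)
Lemma secantE a x y : `|production a x - production a y| = secant a x y * `|x - y|.
Proof.
rewrite /secant; have [->|xy] := eqVneq x y; first by rewrite !subrr !normr0 mulr0.
by rewrite divfK// normr_eq0 subr_eq0.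
Qed.

Lemma secant_ricker a x y : 0 < a ->
  `|ricker (a * x) - ricker (a * y)| / `|a * x - a * y| = expR 2 * secant a x y.
Proof.
move=> a0; rewrite !production_ricker// -!mulrBr !normrM (gtr0_norm a0) (gtr0_norm (expR_gt0 2)).
rewrite /secant; have [->|xy] := eqVneq x y; first by rewrite !subrr !normr0 !mulr0 !mul0r mulr0.
by field; rewrite normr_eq0 subr_eq0 xy gt_eqF.
Qed.

(** [fl * A1] is a lower bound for solutions that start above [A1], and [q]
    the slope of the weight; [v] is varsigma and [r = A2 / A1].  In the first
    case solutions stay above [A1] and the weight is constant.  In the second
    case [fl = r - ln r / v]. *)
Definition floor_data v r fl q : Prop :=
  [/\ fl = 1, q = 0 & r <= expR (v * (r - fl))] \/
  [/\ fl < 1, q = 7 / 4 & expR (v * (r - fl)) = r].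

Lemma floor_data_exists v r : (1 - v) * expR (2 - v) = 1 -> 1 < r ->
  exists fl q, floor_data v r fl q.
Proof.
move=> hv r1; have /andP[v0 v1] := varsigma_bounds hv.
have v00 : v != 0 by rewrite gt_eqF//; lra.
have r0 : 0 < r by lra.
case: (leP 1 (r - ln r / v)) => h.
  exists 1, 0; left; split => //.
  rewrite -{1}(lnK r0) ler_expR mulrBr mulr1.
  have : v * 1 <= v * (r - ln r / v) by rewrite ler_wpM2l//; lra.
  by rewrite mulrBr mulrCA divff// !mulr1; lra.
exists (r - ln r / v), (7 / 4); right; split => //.
have -> : v * (r - (r - ln r / v)) = ln r by field.
by rewrite lnK.
Qed.

Section Pair.
Variables (v A1 A2 fl q a x y : R).
Hypotheses (hv : (1 - v) * expR (2 - v) = 1) (A10 : 0 < A1) (A12 : A1 < A2).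
Hypotheses (fd : floor_data v (A2 / A1) fl q) (a0 : 0 < a) (va : v <= a * A1).

Lemma floor_bounds : 0 < fl <= 1.
Proof.
have A1' := A10; have A12' := A12.
case: fd => [[-> _ _]|[fl1 _ h]]; first by rewrite ltr01 lexx.
rewrite (ltW fl1) andbT.
have r1 : 1 < A2 / A1 by rewrite ltr_pdivlMr// mul1r.
have := floor_ge_ratio hv r1 h; lra.
Qed.

(** The production is unimodal, so that its minimum on [fl A1, A2] is at an
    end.  At the lower end the claim reads [A2/A1 <= e^(a A1 (A2/A1 - fl))],
    which is how [fl] was chosen. *)
Lemma production_floor : fl * A1 <= x -> x <= A2 -> fl * production a A2 <= production a x.
Proof.
move=> mx xA; have /andP[fl0 fl1] := floor_bounds.
have A1' := A10; have A12' := A12.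
have r1 : 1 < A2 / A1 by rewrite ltr_pdivlMr// mul1r.
have aA : a * x <= a * A2 by rewrite ler_pM2l.
have e0 : 0 < expR 2 * a by rewrite mulr_gt0// expR_gt0.
rewrite -(ler_pM2l e0) mulrCA -!production_ricker//.
have y0 : 0 <= ricker (a * A2) by apply: ricker_ge0; rewrite mulr_ge0 ?(ltW a0)//; lra.
case: (leP 1 (a * x)) => ax.
  apply: (@le_trans _ _ (1 * ricker (a * A2))); first by rewrite ler_wpM2r.
  by rewrite mul1r ricker_nincr.
have rle : A2 / A1 <= expR (v * (A2 / A1 - fl)).
  by case: fd => [[_ _]|[_ _ ->]].
have AE : A2 = A2 / A1 * A1 by rewrite divfK// gt_eqF.
set r := A2 / A1 in r1 rle AE.
have hr : r <= expR (a * A1 * (r - fl)).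
  by apply: (le_trans rle); rewrite ler_expR ler_wpM2r//; lra.
apply: (@le_trans _ _ (ricker (a * (fl * A1)))); last first.
  by apply: ricker_ndecr; [exact: ltW|rewrite ler_pM2l].
have eD : expR (2 - a * (fl * A1)) = expR (2 - a * A2) * expR (a * A1 * (r - fl)).
  by rewrite -expRD; congr expR; rewrite AE; ring.
have E0 : 0 <= a * A1 * fl * expR (2 - a * A2).
  by rewrite !mulr_ge0 ?expR_ge0 ?(ltW a0) ?(ltW A10) ?(ltW fl0).
rewrite /ricker eD {1}AE; have := ler_wpM2l E0 hr; lra.
Qed.

Lemma weight_scaled : a * weight A1 q x = Num.min (a * A1) (a * A1 + q * (a * x - a * A1)).
Proof. by rewrite /weight minr_pMr ?(ltW a0)// mulrDr; congr Num.min; ring. Qed.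

(** [ricker_secant_weight] in the original units. *)
Lemma secant_weight_le : fl * A1 <= x -> x <= A2 -> A1 <= y ->
  secant a x y * weight A1 q x <= A1 / expR 2.
Proof.
move=> mx xA yA; have A1' := A10; have /andP[fl0 _] := floor_bounds.
have e0 := @expR_gt0 R 2; have x0 : 0 <= x by apply: le_trans mx; rewrite mulr_ge0// ltW.
have vy : v <= a * y by apply: (le_trans va); rewrite ler_pM2l.
rewrite ler_pdivlMr// -(ler_pM2l a0).
rewrite (_ : a * (_ * _) = expR 2 * secant a x y * (a * weight A1 q x)); last by ring.
rewrite -secant_ricker// weight_scaled.
have [xy|xy] := eqVneq (a * x) (a * y).
  by rewrite xy !subrr normr0 !mul0r mulr_ge0 ?(ltW a0)// ltW.
rewrite mulrAC ler_pdivrMr ?normr_gt0 ?subr_eq0//.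
case: fd => [[fl1 -> _]|[_ -> _]]; last by apply: (ricker_secant_weight hv) => //; rewrite mulr_ge0// ltW.
rewrite mul0r addr0 minxx mulrC ler_wpM2l ?mulr_ge0 ?(ltW a0) ?(ltW A10)//.
apply: (ricker_lipschitz hv) => //; apply: (le_trans va).
by rewrite ler_pM2l//; move: mx; rewrite fl1 mul1r.
Qed.

(** [ricker_weighted_secant] in the original units. *)
Lemma secant_weight_le_dip : fl < 1 -> fl * A1 <= x -> x <= A2 -> A1 <= y -> y <= A2 ->
  secant a x y * weight A1 q x <=
  q * (production a x - production a A2) + A1 / expR 2 / 2 + A1 / A2 / (a * expR 1) / 2.
Proof.
move=> fl1 mx xA yA yA2; have A1' := A10; have A12' := A12.
case: fd => [[fl1' _ _]|[_ -> h]]; first by move: fl1; rewrite fl1' ltxx.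
have e0 := @expR_gt0 R 2; have e10 := @expR_gt0 R 1.
have r1 : 1 < A2 / A1 by rewrite ltr_pdivlMr// mul1r.
have AE : a * A1 * (A2 / A1) = a * A2 by field; rewrite gt_eqF.
have amu : a * A1 * fl <= a * x by rewrite -mulrA ler_pM2l// mulrC.
have ax : a * x <= a * A1 * (A2 / A1) by rewrite AE ler_pM2l.
have ay : a * A1 <= a * y by rewrite ler_pM2l.
have ay2 : a * y <= a * A1 * (A2 / A1) by rewrite AE ler_pM2l.
have := ricker_weighted_secant hv r1 h fl1 va amu ax ay ay2.
have -> : Num.min (a * A1) (a * A1 + 7 / 4 * (a * x - a * A1)) = a * weight A1 (7 / 4) x.
  by rewrite /weight minr_pMr ?(ltW a0)// mulrDr; congr Num.min; ring.
rewrite AE secant_ricker// !production_ricker// => hP.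
have k0 : 0 < expR 2 * a by rewrite mulr_gt0.
rewrite -(ler_pM2l k0).
have e2 : expR 2 = expR 1 * expR 1 :> R by rewrite -expRD; congr expR; ring.
have -> : expR 2 * a * (7 / 4 * (production a x - production a A2) + A1 / expR 2 / 2 + A1 / A2 / (a * expR 1) / 2) =
  7 / 4 * (expR 2 * a * production a x - expR 2 * a * production a A2) + a * A1 / 2 + expR 1 / (2 * (A2 / A1)).
  rewrite e2; field; rewrite !gt_eqF//; lra.
by apply: le_trans hP; rewrite le_eqVlt; apply/orP; left; apply/eqP; ring.
Qed.

End Pair.
End Nicholson.

(** * Extremal values of the coefficients *)

Section Extrema.
Set Implicit Arguments.
Unset Strict Implicit.
Context {R : realType}.

Lemma fmax_ge (I : finType) (F : I -> R) i : F i <= fmax F.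
Proof.
apply: ub_le_sup; last by exists i.
exists (\sum_j `|F j|) => _ [j _ <-].
apply: (le_trans (ler_norm _)); rewrite (bigD1 j)//= lerDl.
exact: sumr_ge0.
Qed.

Lemma fmax_le (I : finType) (F : I -> R) M (i0 : I) : (forall i, F i <= M) -> fmax F <= M.
Proof. by move=> h; apply: ge_sup => [|_ [i _ <-]//]; exists (F i0), i0. Qed.

Lemma fmin_le (I : finType) (F : I -> R) i : fmin F <= F i.
Proof.
apply: ge_inf; last by exists i.
exists (- \sum_j `|F j|) => _ [j _ <-]; rewrite lerNl.
apply: (le_trans (ler_norm _)); rewrite normrN (bigD1 j)//= lerDl.
exact: sumr_ge0.
Qed.

Lemma fmin_gt0 (I : finType) (F : I -> R) (i0 : I) : (forall i, 0 < F i) -> 0 < fmin F.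
Proof.
move=> /fin_pos_lower_bound[m m0 h]; apply: (lt_le_trans m0).
by apply: lb_le_inf => [|_ [i _ <-]//]; exists (F i0), i0.
Qed.

Lemma ap_nonneg_bounds (T : set R) (f : R -> R) : ap_nonneg T f ->
  forall t, T t -> infT T f <= f t <= supT T f.
Proof.
move=> [[[M [_ hM]] _ _] _] t Tt.
have {}hM u : T u -> `|f u| <= M + 1.
  by move=> Tu; apply: (hM (M + 1)); [rewrite ltrDl|exists u].
apply/andP; split; [apply: ge_inf|apply: ub_le_sup]; try by exists t.
  exists (- (M + 1)) => _ [u Tu <-]; have := hM u Tu; rewrite ler_norml; lra.
exists (M + 1) => _ [u Tu <-]; have := hM u Tu; rewrite ler_norml; lra.
Qed.

End Extrema.

(** * Decay of differences of solutions *)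

Section System.
Set Implicit Arguments.
Unset Strict Implicit.
Context {R : realType}.
Variables (T : set R) (n : nat)
  (c : 'I_n -> R -> R) (b beta alpha tau : 'I_n -> 'I_n -> R -> R)
  (A1 A2 v : R).
Hypotheses
  (hv : (1 - v) * expR (2 - v) = 1)
  (clT : closed T)
  (c_ap : forall i, ap_nonneg T (c i))
  (b_ap : forall i k, k != i -> ap_nonneg T (b i k))
  (beta_ap : forall i j, ap_nonneg T (beta i j))
  (alpha_ap : forall i j, ap_nonneg T (alpha i j))
  (tau_ap : forall i j, ap_nonneg T (tau i j))
  (c_pos : forall i, 0 < infT T (c i))
  (b_pos : forall i k, k != i -> 0 < infT T (b i k))
  (beta_pos : forall i j, 0 < infT T (beta i j))
  (alpha_pos : forall i j, 0 < infT T (alpha i j))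
  (tau_T : forall i j t, T t -> T (t - tau i j t))
  (A1_pos : 0 < A1) (A12 : A1 < A2)
  (v_le : forall i j, v <= infT T (alpha i j) * A1)
  (A2_gt : forall i, \sum_(j < n) supT T (beta i j) / (infT T (alpha i j) * expR 1)
     < (infT T (c i) - \sum_(k < n | k != i) supT T (b i k)) * A2)
  (A1_lt : forall i, (supT T (c i) - \sum_(k < n | k != i) infT T (b i k)) * A1
     < \sum_(j < n) infT T (beta i j) * production (supT T (alpha i j)) A2)
  (c_reg : forall i, positively_regressive T (fun t => - c i t))
  (contraction : forall i,
     \sum_(k < n | k != i) supT T (b i k)
     + \sum_(j < n) supT T (beta i j) / expR 2 < infT T (c i)).

Lemma alpha_gt0 i j t : T t -> 0 < alpha i j t.
Proof.
by move=> Tt; have /andP[h _] := ap_nonneg_bounds (alpha_ap i j) Tt; apply: lt_le_trans h.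
Qed.

Lemma v_le_alpha i j t : T t -> v <= alpha i j t * A1.
Proof.
move=> Tt; apply: (le_trans (v_le i j)); rewrite ler_wpM2r ?(ltW A1_pos)//.
by have /andP[] := ap_nonneg_bounds (alpha_ap i j) Tt.
Qed.

Lemma beta_gt0 i j t : T t -> 0 < beta i j t.
Proof.
by move=> Tt; have /andP[h _] := ap_nonneg_bounds (beta_ap i j) Tt; apply: lt_le_trans h.
Qed.

Lemma b_gt0 i k t : k != i -> T t -> 0 < b i k t.
Proof.
by move=> ki Tt; have /andP[h _] := ap_nonneg_bounds (b_ap ki) Tt; apply: lt_le_trans h; exact: b_pos.
Qed.

Lemma sum_b_bounds i t : T t -> \sum_(k < n | k != i) infT T (b i k) <=
  \sum_(k < n | k != i) b i k t <= \sum_(k < n | k != i) supT T (b i k).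
Proof.
by move=> Tt; apply/andP; split; apply: ler_sum => k ki;
  have /andP[] := ap_nonneg_bounds (b_ap ki) Tt.
Qed.

Lemma beta_term_le i j t : T t -> beta i j t / (alpha i j t * expR 1) <=
  supT T (beta i j) / (infT T (alpha i j) * expR 1).
Proof.
move=> Tt; have /andP[_ h1] := ap_nonneg_bounds (beta_ap i j) Tt.
have /andP[h2 _] := ap_nonneg_bounds (alpha_ap i j) Tt.
have e0 := @expR_gt0 R 1.
apply: ler_pM => //; first exact: ltW (beta_gt0 _ _ Tt).
  by rewrite invr_ge0 mulr_ge0 ?(ltW e0)// ltW// alpha_gt0.
by rewrite lef_pV2 ?posrE ?mulr_gt0 ?alpha_gt0// ler_pM2r.
Qed.

Lemma production_term_ge i j t : T t -> infT T (beta i j) * production (supT T (alpha i j)) A2 <=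
  beta i j t * production (alpha i j t) A2.
Proof.
move=> Tt; have /andP[h1 _] := ap_nonneg_bounds (beta_ap i j) Tt.
have /andP[_ h2] := ap_nonneg_bounds (alpha_ap i j) Tt.
have A20 : 0 <= A2 by exact: ltW (lt_trans A1_pos A12).
by apply: ler_pM => //; [exact: ltW|exact: production_ge0|exact: production_antitone].
Qed.

(** At the level [A2] the right side of the equation is negative, because
    [x e^(- alpha x) <= 1 / (alpha e)]. *)
Lemma row_upper i t (xk xd : 'I_n -> R) : T t -> (forall k, xk k <= A2) ->
  \sum_(k < n | k != i) b i k t * xk k + \sum_(j < n) beta i j t * production (alpha i j t) (xd j)
  < c i t * A2.
Proof.
move=> Tt xA; have A20 : 0 < A2 := lt_trans A1_pos A12.
have h1 : \sum_(k < n | k != i) b i k t * xk k <= (\sum_(k < n | k != i) supT T (b i k)) * A2.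
  rewrite mulr_suml; apply: ler_sum => k ki.
  apply: (@le_trans _ _ (b i k t * A2)); first by rewrite ler_wpM2l// ltW// b_gt0.
  by rewrite ler_wpM2r ?(ltW A20)//; have /andP[] := ap_nonneg_bounds (b_ap ki) Tt.
have h2 : \sum_(j < n) beta i j t * production (alpha i j t) (xd j) <=
    \sum_(j < n) supT T (beta i j) / (infT T (alpha i j) * expR 1).
  apply: ler_sum => j _; apply: le_trans (beta_term_le i j Tt).
  by rewrite ler_wpM2l ?(ltW (beta_gt0 _ _ Tt))// production_le// alpha_gt0.
have h3 := A2_gt i.
have /andP[h4 _] := ap_nonneg_bounds (c_ap i) Tt.
have : infT T (c i) * A2 <= c i t * A2 by rewrite ler_wpM2r// ltW.
by lra.
Qed.

Variables (fl q : R).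
Hypothesis fd : floor_data v (A2 / A1) fl q.

Let fl_bounds : 0 < fl <= 1 := floor_bounds hv A1_pos A12 fd.

(** At the level [fl * A1] the right side of the equation is positive, because
    the production is at least [fl] times its value at [A2]. *)
Lemma row_lower i t (xk xd : 'I_n -> R) : T t -> (forall k, fl * A1 <= xk k) ->
  (forall j, fl * A1 <= xd j <= A2) ->
  c i t * (fl * A1) < \sum_(k < n | k != i) b i k t * xk k
    + \sum_(j < n) beta i j t * production (alpha i j t) (xd j).
Proof.
move=> Tt xA xdA; have /andP[f0 f1] := fl_bounds.
have m0 : 0 < fl * A1 by rewrite mulr_gt0.
have h1 : (\sum_(k < n | k != i) infT T (b i k)) * (fl * A1) <= \sum_(k < n | k != i) b i k t * xk k.
  rewrite mulr_suml; apply: ler_sum => k ki.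
  apply: ler_pM => //; [exact: ltW (b_pos ki)|exact: ltW|].
  by have /andP[] := ap_nonneg_bounds (b_ap ki) Tt.
have h2 : fl * \sum_(j < n) infT T (beta i j) * production (supT T (alpha i j)) A2 <=
    \sum_(j < n) beta i j t * production (alpha i j t) (xd j).
  rewrite mulr_sumr; apply: ler_sum => j _.
  apply: (@le_trans _ _ (fl * (beta i j t * production (alpha i j t) A2))).
    by rewrite ler_wpM2l ?(ltW f0)// production_term_ge.
  rewrite mulrCA ler_wpM2l ?(ltW (beta_gt0 _ _ Tt))//.
  have /andP[x1 x2] := xdA j.
  exact: (production_floor hv A1_pos A12 fd (alpha_gt0 i j Tt) (v_le_alpha i j Tt)).
have h3 := A1_lt i; rewrite -(ltr_pM2l f0) in h3.
have /andP[_ h4] := ap_nonneg_bounds (c_ap i) Tt.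
have : c i t * (fl * A1) <= supT T (c i) * (fl * A1) by rewrite ler_wpM2r// ltW.
by lra.
Qed.

(** The smaller of the slacks in the two inequalities of [row_weight]. *)
Definition row_slack i : R := Num.min
  (A1 * (infT T (c i) - \sum_(k < n | k != i) supT T (b i k) - \sum_(j < n) supT T (beta i j) / expR 2))
  (7 / 4 * (\sum_(j < n) infT T (beta i j) * production (supT T (alpha i j)) A2
    - (supT T (c i) - \sum_(k < n | k != i) infT T (b i k)) * A1)).

Lemma row_slack_gt0 i : 0 < row_slack i.
Proof.
rewrite lt_min; apply/andP; split.
  by rewrite mulr_gt0// subr_gt0 ltrBrDl contraction.
by rewrite mulr_gt0// subr_gt0.
Qed.

(** The two branches of the weight are supersolutions of the linear inequality
    satisfied by the deviations.  The first inequality is the branch [A1]; the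
    second is the branch [A1 + q (x - A1)], from which the terms with [x_k]
    have cancelled. *)
Lemma row_weight i t (xd yd : 'I_n -> R) : T t ->
  (forall j, fl * A1 <= xd j <= A2) -> (forall j, A1 <= yd j <= A2) ->
  let G := \sum_(j < n) beta i j t * (secant (alpha i j t) (xd j) (yd j) * weight A1 q (xd j)) in
  let C := c i t - \sum_(k < n | k != i) b i k t in
  G + row_slack i <= C * A1 /\
  G + row_slack i <= q * \sum_(j < n) beta i j t * production (alpha i j t) (xd j) + C * (1 - q) * A1.
Proof.
move=> Tt xA yA G C.
have A20 : 0 < A2 := lt_trans A1_pos A12.
have e0 := @expR_gt0 R 2.
have /andP[c1 c2] := ap_nonneg_bounds (c_ap i) Tt.
have /andP[b1 b2] := sum_b_bounds i Tt.
have C1 : infT T (c i) - \sum_(k < n | k != i) supT T (b i k) <= C by rewrite /C; lra.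
have C2 : C <= supT T (c i) - \sum_(k < n | k != i) infT T (b i k) by rewrite /C; lra.
have hG : G <= A1 * \sum_(j < n) supT T (beta i j) / expR 2.
  rewrite mulr_sumr; apply: ler_sum => j _; rewrite [leRHS]mulrCA.
  have /andP[x1 x2] := xA j; have /andP[y1 y2] := yA j.
  apply: (@le_trans _ _ (beta i j t * (A1 / expR 2))).
    rewrite ler_wpM2l ?(ltW (beta_gt0 _ _ Tt))//.
    exact: (secant_weight_le hv A1_pos A12 fd (alpha_gt0 i j Tt) (v_le_alpha i j Tt)).
  rewrite ler_wpM2r//; first by rewrite divr_ge0 ?(ltW e0)// ltW.
  by have /andP[] := ap_nonneg_bounds (beta_ap i j) Tt.
have K1 : G + row_slack i <= C * A1.
  have : row_slack i <= A1 * (infT T (c i) - \sum_(k < n | k != i) supT T (b i k)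
      - \sum_(j < n) supT T (beta i j) / expR 2) by rewrite ge_min lexx.
  by have := ler_wpM2l (ltW A1_pos) C1; lra.
split => //; case: (fd) => [[_ -> _]|[mu1 q74 _]].
  by rewrite mul0r add0r subr0 mulr1.
have s2 : row_slack i <= 7 / 4 * (\sum_(j < n) infT T (beta i j) * production (supT T (alpha i j)) A2
    - (supT T (c i) - \sum_(k < n | k != i) infT T (b i k)) * A1) by rewrite ge_min lexx orbT.
have gA2 : \sum_(j < n) infT T (beta i j) * production (supT T (alpha i j)) A2 <=
    \sum_(j < n) beta i j t * production (alpha i j t) A2.
  by apply: ler_sum => j _; exact: production_term_ge.
have B1 : \sum_(j < n) beta i j t / expR 2 <= \sum_(j < n) supT T (beta i j) / expR 2.
  apply: ler_sum => j _; rewrite ler_wpM2r ?invr_ge0 ?(ltW e0)//.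
  by have /andP[] := ap_nonneg_bounds (beta_ap i j) Tt.
have B2 : \sum_(j < n) beta i j t / (alpha i j t * expR 1) <=
    \sum_(j < n) supT T (beta i j) / (infT T (alpha i j) * expR 1).
  by apply: ler_sum => j _; exact: beta_term_le.
have B2' : A1 / A2 * \sum_(j < n) beta i j t / (alpha i j t * expR 1) <=
    (infT T (c i) - \sum_(k < n | k != i) supT T (b i k)) * A1.
  have A120 : 0 < A1 / A2 by rewrite divr_gt0.
  apply: (le_trans (ler_wpM2l (ltW A120) (le_trans B2 (ltW (A2_gt i))))).
  by rewrite mulrCA -mulrA mulVf ?mulr1// gt_eqF.
have B1' : A1 * \sum_(j < n) beta i j t / expR 2 <=
    (infT T (c i) - \sum_(k < n | k != i) supT T (b i k)) * A1.
  rewrite mulrC ler_pM2r//; apply: (le_trans B1).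
  by have := contraction i; lra.
have main : G <= q * (\sum_(j < n) beta i j t * production (alpha i j t) (xd j) -
    \sum_(j < n) beta i j t * production (alpha i j t) A2) +
    (A1 * \sum_(j < n) beta i j t / expR 2) / 2 +
    (A1 / A2 * \sum_(j < n) beta i j t / (alpha i j t * expR 1)) / 2.
  rewrite -sumrB !mulr_sumr !mulr_suml -!big_split/=; apply: ler_sum => j _.
  have /andP[x1 x2] := xA j; have /andP[y1 y2] := yA j.
  have := secant_weight_le_dip hv A1_pos A12 fd (alpha_gt0 i j Tt) (v_le_alpha i j Tt) mu1 x1 x2 y1 y2.
  move=> /(ler_wpM2l (ltW (beta_gt0 i j Tt))) => h; apply: (le_trans h).
  by rewrite le_eqVlt; apply/orP; left; apply/eqP; ring.
have hC := ler_wpM2r (ltW A1_pos) C2.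
have hC1 := ler_wpM2r (ltW A1_pos) C1.
by move: main; rewrite q74; lra.
Qed.

Notation rhs := (nicholson_rhs c b beta alpha tau).
Notation hist := (initial_set T tau).
Notation after t0 := (T `&` [set t | t0 <= t]).

Lemma rhsE (x : R -> 'rV[R]_n) i t : rhs x i t = - c i t * x t ord0 i
  + \sum_(k < n | k != i) b i k t * x t ord0 k
  + \sum_(j < n) beta i j t * production (alpha i j t) (x (t - tau i j t) ord0 i).
Proof. by rewrite /nicholson_rhs; congr (_ + _); apply: eq_bigr => j _; rewrite /production mulrA. Qed.

Lemma tau_le_theta i j t : T t -> 0 <= tau i j t <= theta T tau.
Proof.
move=> Tt; rewrite (tau_ap i j).2//=.
have /andP[_ h] := ap_nonneg_bounds (tau_ap i j) Tt; apply: (le_trans h).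
exact: (fmax_ge (fun ij => supT T (tau ij.1 ij.2)) (i, j)).
Qed.

Lemma theta_ge0 (i : 'I_n) t : T t -> 0 <= theta T tau.
Proof. by move=> Tt; have /andP[h1 h2] := tau_le_theta i i Tt; exact: le_trans h2. Qed.

Lemma hist_t0 (i : 'I_n) t0 : T t0 -> hist t0 t0.
Proof.
by move=> Tt0; split => //=; rewrite lexx andbT gerBl; exact: theta_ge0 i _ Tt0.
Qed.

Lemma mu_after t0 i t : after t0 t -> 0 <= 1 - mu (after t0) t * c i t.
Proof.
move=> [Tt /= t0t]; rewrite mu_restrict//.
by have [_ /(_ t Tt)] := c_reg i; rewrite mulrN => /ltW.
Qed.

Section Solution.
Variables (t0 : R) (x : R -> 'rV[R]_n).
Hypotheses (Tt0 : T t0) (hx : forall s i, hist t0 s -> A1 <= x s ord0 i <= A2)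
  (sx : solution_on c b beta alpha tau (after t0) x).

Lemma solution_upper i t : T t -> t0 - theta T tau <= t -> x t ord0 i <= A2.
Proof.
move=> Tt tt; case: (leP t t0) => tt0.
  by have /andP[] : A1 <= x t ord0 i <= A2 by apply: hx; split => //=; rewrite tt.
pose u (k : 'I_n) s := A2 + -1 * x s ord0 k.
suff : 0 <= u i t by rewrite /u; lra.
apply: (@barrier R (after t0) t0 _ u (fun k s => 0 + -1 * rhs x k s) c) => //.
- exact: closed_restrict.
- by split => /=.
- by move=> s [].
- move=> k s Ss; apply: delta_deriveD; first exact: delta_derive_cst.
  by apply: delta_deriveZ; exact: sx.
- by move=> k s Ss; exact: mu_after.
- by move=> k; have /andP[_] := hx k (hist_t0 k Tt0); rewrite /u; lra.
- move=> s k Ss below; case: (Ss) => Ts _.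
  have h := @row_upper k s (fun k => x s ord0 k) (fun j => x (s - tau k j s) ord0 k) Ts.
  have {}h := h (fun l => ltac:(have := below s l Ss (lexx _); rewrite /u; lra)).
  by rewrite /u rhsE; lra.
- by split => //=; exact: ltW.
Qed.

Lemma solution_range i t : T t -> t0 - theta T tau <= t -> fl * A1 <= x t ord0 i <= A2.
Proof.
have /andP[f0 f1] := fl_bounds.
have flA : fl * A1 <= A1 by rewrite ger_pMl.
move=> Tt tt; rewrite solution_upper// andbT; case: (leP t t0) => tt0.
  have /andP[h _] : A1 <= x t ord0 i <= A2 by apply: hx; split => //=; rewrite tt.
  exact: le_trans h.
pose u (k : 'I_n) s := - (fl * A1) + x s ord0 k.
suff : 0 <= u i t by rewrite /u; lra.
apply: (@barrier R (after t0) t0 _ u (fun k s => 0 + rhs x k s) c) => //.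
- exact: closed_restrict.
- by split => /=.
- by move=> s [].
- move=> k s Ss; apply: delta_deriveD; first exact: delta_derive_cst.
  exact: sx.
- by move=> k s Ss; exact: mu_after.
- by move=> k; have /andP[h _] := hx k (hist_t0 k Tt0); rewrite /u; lra.
- move=> s k Ss below; case: (Ss) => Ts /= t0s.
  have h1 l : fl * A1 <= x s ord0 l by have := below s l Ss (lexx _); rewrite /u; lra.
  have h2 j : fl * A1 <= x (s - tau k j s) ord0 k <= A2.
    have /andP[d0 d1] := tau_le_theta k j Ts; have Td := tau_T k j Ts.
    rewrite solution_upper// ?andbT; last by lra.
    case: (leP t0 (s - tau k j s)) => dt0.
      have := below (s - tau k j s) k; rewrite /u => /(_ _ _)/=.
      by move=> bl; have := bl ltac:(by []) ltac:(lra); lra.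
    have /andP[h _] : A1 <= x (s - tau k j s) ord0 k <= A2.
      by apply: hx; split => //=; apply/andP; split; lra.
    exact: le_trans h.
  have h := @row_lower k s (fun k => x s ord0 k) (fun j => x (s - tau k j s) ord0 k) Ts h1 h2.
  by rewrite /u rhsE; lra.
- by split => //=; exact: ltW.
Qed.

End Solution.

Lemma q_bounds : 0 <= q <= 7 / 4.
Proof. by case: fd => [[_ -> _]|[_ -> _]]; apply/andP; split; lra. Qed.

(** The slack of each row absorbs the derivative of the exponential (first
    term) and its growth [e^(lam theta)] across a delay (second term). *)
Lemma rate_exists : exists2 lam, 0 < lam & forall i t, T t ->
  lam * (A1 + q * A2) + (expR (lam * theta T tau) - 1) * (supT T (c i) * A1) < row_slack i.
Proof.
have A20 : 0 < A2 := lt_trans A1_pos A12.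
have /andP[q0 _] := q_bounds.
have [s s0 hs] := fin_pos_lower_bound row_slack_gt0.
have [[t Tt]|noT] := pselect (T !=set0); last first.
  by exists 1 => // i t Tt; case: noT; exists t.
have cM0 i : 0 < supT T (c i).
  by have /andP[h1 h2] := ap_nonneg_bounds (c_ap i) Tt; apply: lt_le_trans (le_trans h1 h2).
pose Kc := \sum_i supT T (c i) * A1.
have Kc0 : 0 <= Kc by apply: sumr_ge0 => i _; rewrite mulr_ge0// ltW.
pose th := `|theta T tau|.
have th0 : 0 <= th by rewrite normr_ge0.
pose V := A1 + q * A2 + 2 * th * Kc + 1.
have V0 : 0 < V.
  have : 0 <= q * A2 by rewrite mulr_ge0// ltW.
  have : 0 <= th * Kc by rewrite mulr_ge0.
  by have := A1_pos; rewrite /V; lra.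
pose iv := 2 * (th + 1) + V / s.
have Vs : 0 < V / s by rewrite divr_gt0.
have iv0 : 0 < iv by rewrite /iv; lra.
exists iv^-1; first by rewrite invr_gt0.
set lam := iv^-1 => i u Tu.
have lam0 : 0 < lam by rewrite invr_gt0.
have lam1 : lam * iv = 1 by rewrite mulVf// gt_eqF.
have lt : lam * th <= 1 / 2.
  have : 0 <= lam * (V / s) by rewrite mulr_ge0 ?ltW.
  by move: lam1; rewrite /iv; lra.
have lV : lam * V <= s.
  have : 0 <= lam * (2 * (th + 1)) by rewrite mulr_ge0 ?(ltW lam0)//; lra.
  have -> : lam * V = lam * (V / s) * s by rewrite -mulrA divfK// gt_eqF.
  move=> h; rewrite -[leRHS]mul1r ler_pM2r//; move: lam1; rewrite /iv; lra.
have x0 : 0 <= lam * th by rewrite mulr_ge0// ltW.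
have ex : expR (lam * theta T tau) - 1 <= 2 * (lam * th).
  have h1 : expR (lam * theta T tau) <= expR (lam * th).
    by rewrite ler_expR ler_wpM2l ?(ltW lam0)// ler_norm.
  have h2 := expR_ge1Dx (- (lam * th)).
  have h3 : expR (lam * th) * expR (- (lam * th)) = 1 by rewrite -expRD subrr expR0.
  have h4 := ler_wpM2l (expR_ge0 (lam * th)) h2; rewrite h3 in h4.
  have y1 : 0 < 1 - lam * th by lra.
  have : expR (lam * th) <= 1 + 2 * (lam * th).
    rewrite -(ler_pM2r y1).
    have : 0 <= lam * th * (1 - 2 * (lam * th)) by rewrite mulr_ge0//; lra.
    by lra.
  by lra.
have Ki : supT T (c i) * A1 <= Kc.
  rewrite /Kc (bigD1 i)//= lerDl; apply: sumr_ge0 => k _.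
  by rewrite mulr_ge0 ?(ltW A1_pos)// ltW.
have : (expR (lam * theta T tau) - 1) * (supT T (c i) * A1) <= 2 * (lam * th) * Kc.
  apply: (@le_trans _ _ (2 * (lam * th) * (supT T (c i) * A1))).
    by rewrite ler_wpM2r// mulr_ge0 ?(ltW A1_pos)// ltW.
  by rewrite ler_wpM2l// mulr_ge0.
have := hs i; move: lV; rewrite /V; lra.
Qed.

Definition decay_rate : R := s2val (cid2 rate_exists).

Lemma decay_rate_gt0 : 0 < decay_rate.
Proof. by rewrite /decay_rate; case: cid2. Qed.

Lemma decay_rateP i t : T t ->
  decay_rate * (A1 + q * A2) + (expR (decay_rate * theta T tau) - 1) * (supT T (c i) * A1)
  < row_slack i.
Proof. by rewrite /decay_rate; case: cid2 => lam /= _ h Tt; exact: h Tt. Qed.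

Section Comparison.
Variables (t0 N : R) (x y : R -> 'rV[R]_n).
Hypotheses (Tt0 : T t0) (N0 : 0 < N)
  (hx : forall s i, hist t0 s -> A1 <= x s ord0 i <= A2)
  (sx : solution_on c b beta alpha tau (after t0) x)
  (hy : forall s i, T s -> t0 - theta T tau <= s -> A1 <= y s ord0 i <= A2)
  (sy : solution_on c b beta alpha tau (after t0) y)
  (hxy : forall s i, hist t0 s -> `|x s ord0 i - y s ord0 i| <= N * A1).

Notation e := (decay T decay_rate t0).
Notation p := (ominus T decay_rate).

Let slope (kap : bool) : R := if kap then q else 0.
Let V (kap : bool) i s := A1 - slope kap * A1 + slope kap * x s ord0 i.
Let gap (k : 'I_n * bool * bool) s :=
  N * (e s * V k.1.2 k.1.1 s) + (-1) ^+ k.2 * (x s ord0 k.1.1 + -1 * y s ord0 k.1.1).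
Let dgap (k : 'I_n * bool * bool) s :=
  N * (p s * e s * V k.1.2 k.1.1 (sigma (after t0) s)
       + e s * (0 + slope k.1.2 * rhs x k.1.1 s))
  + (-1) ^+ k.2 * (rhs x k.1.1 s + -1 * rhs y k.1.1 s).

Lemma slope_ge0 kap : 0 <= slope kap.
Proof. by case: kap => //=; have /andP[] := q_bounds. Qed.

Lemma gap_norm i kap s : 0 <= gap (i, kap, false) s -> 0 <= gap (i, kap, true) s ->
  `|x s ord0 i - y s ord0 i| <= N * (e s * V kap i s).
Proof. by rewrite /gap/= expr0 expr1 ler_norml; lra. Qed.

Lemma decay_delay i j t : T t -> t0 <= t -> t0 <= t - tau i j t ->
  e (t - tau i j t) <= expR (decay_rate * theta T tau) * e t.
Proof.
move=> Tt t0t dt0; have Td := tau_T i j Tt; have /andP[d0 d1] := tau_le_theta i j Tt.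
have dt : t - tau i j t <= t by lra.
rewrite (decayM decay_rate_gt0 Tt0 Td Tt dt).
have ed := decay_gt0 decay_rate_gt0 Tt0 Td.
rewrite mulrCA -{1}[e _]mulr1 ler_pM2l//.
have := step_inf_lower decay_rate_gt0 Tt dt.
move=> /(ler_wpM2l (expR_ge0 (decay_rate * theta T tau))); apply: le_trans.
rewrite -expRD -[leLHS]expR0 ler_expR.
have -> : t - (t - tau i j t) = tau i j t by ring.
by rewrite -mulrBr mulr_ge0 ?(ltW decay_rate_gt0)// subr_ge0.
Qed.

(** Delayed arguments before [t0] carry no factor [e]; the elapsed time is at
    most [theta]. *)
Lemma decay_delay0 i j t : T t -> t0 <= t -> t - tau i j t <= t0 ->
  1 <= expR (decay_rate * theta T tau) * e t.
Proof.
move=> Tt t0t dt0; have /andP[d0 d1] := tau_le_theta i j Tt.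
rewrite /decay t0t; have := step_inf_lower decay_rate_gt0 Tt t0t.
move=> /(ler_wpM2l (expR_ge0 (decay_rate * theta T tau))); apply: le_trans.
rewrite -expRD -[leLHS]expR0 ler_expR -mulrBr mulr_ge0 ?(ltW decay_rate_gt0)//.
lra.
Qed.

(** The equations of [x] and [y] share their decay terms, which cancel on the
    left side. *)
Lemma sum_norm_le i t kap (B : R) : after t0 t ->
  (forall k, `|x t ord0 k - y t ord0 k| <= N * (e t * V kap k t)) ->
  (forall j, `|x (t - tau i j t) ord0 i - y (t - tau i j t) ord0 i| <=
     N * (B * e t * weight A1 q (x (t - tau i j t) ord0 i))) ->
  `|rhs x i t - rhs y i t + c i t * (x t ord0 i - y t ord0 i)| <=
  N * e t * (\sum_(k < n | k != i) b i k t * V kap k t + B * \sum_(j < n) beta i j t *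
    (secant (alpha i j t) (x (t - tau i j t) ord0 i) (y (t - tau i j t) ord0 i)
     * weight A1 q (x (t - tau i j t) ord0 i))).
Proof.
move=> [Tt _] hk hj; rewrite !rhsE.
set bx := \sum_(k < n | _) _ * x _ _ _; set by_ := \sum_(k < n | _) _ * y _ _ _.
set fx := \sum_(j < n) _ * production _ (x _ _ _); set fy := \sum_(j < n) _ * production _ (y _ _ _).
have -> : - c i t * x t ord0 i + bx + fx - (- c i t * y t ord0 i + by_ + fy) +
    c i t * (x t ord0 i - y t ord0 i) = (bx - by_) + (fx - fy) by ring.
apply: (le_trans (ler_normD _ _)); rewrite mulrDr; apply: lerD.
  rewrite /bx /by_ -sumrB mulr_sumr; apply: (le_trans (ler_norm_sum _ _ _)).
  apply: ler_sum => k ki; have b0 := b_gt0 ki Tt.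
  rewrite -mulrBr normrM gtr0_norm//.
  by have := ler_wpM2l (ltW b0) (hk k); lra.
rewrite /fx /fy -sumrB mulrA mulr_sumr; apply: (le_trans (ler_norm_sum _ _ _)).
apply: ler_sum => j _; have b0 := beta_gt0 i j Tt.
rewrite -mulrBr normrM gtr0_norm// secantE.
have := ler_wpM2l (secant_ge0 (alpha i j t) (x (t - tau i j t) ord0 i) (y (t - tau i j t) ord0 i)) (hj j).
by move=> /(ler_wpM2l (ltW b0)); lra.
Qed.

(** The comparison principle for the functions [N e V - (x - y)] and
    [N e V + (x - y)], where [V] ranges over the two branches of the weight. *)
Lemma gap_ge0 t k : T t -> t0 <= t -> 0 <= gap k t.
Proof.
move=> Tt t0t; have A20 : 0 < A2 := lt_trans A1_pos A12.
have l0 := decay_rate_gt0.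
apply: (@barrier R (after t0) t0 _ gap dgap (fun k => c k.1.1)) => //.
- exact: closed_restrict.
- by split => /=.
- by move=> s [].
- move=> [[i kap] sg] s Ss; case: (Ss) => Ts t0s.
  apply: delta_deriveD; apply: delta_deriveZ.
    apply: delta_deriveM => //.
      by apply: delta_derive_restrict => //; exact: decay_derive.
    apply: delta_deriveD; first exact: delta_derive_cst.
    by apply: delta_deriveZ; exact: sx.
  by apply: delta_deriveD; [exact: sx|apply: delta_deriveZ; exact: sy].
- by move=> k' s Ss; exact: mu_after.
- move=> [[i kap] sg]; rewrite /gap/= decay0//.
  have h0 := hist_t0 i Tt0; have /andP[x1 _] := hx i h0.
  have := hxy i h0; rewrite ler_norml => /andP[h1 h2].
  have : 0 <= N * (slope kap * (x t0 ord0 i - A1)).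
    by rewrite !mulr_ge0 ?slope_ge0 ?(ltW N0)// subr_ge0.
  by rewrite /V; case: sg => /=; rewrite ?expr0 ?expr1; lra.
- move=> s [[i kap] sg] Ss below; case: (Ss) => Ts /= t0s.
  have es := decay_gt0 l0 Tt0 Ts.
  have nk kap' k' : `|x s ord0 k' - y s ord0 k'| <= N * (e s * V kap' k' s).
    by apply: gap_norm; apply: below.
  set B := expR (decay_rate * theta T tau).
  have B0 : 0 < B by exact: expR_gt0.
  have Td j := tau_T i j Ts.
  have dr j : t0 - theta T tau <= s - tau i j s.
    by have /andP[d0 d1] := tau_le_theta i j Ts; lra.
  have ds j : s - tau i j s <= s by have /andP[d0 d1] := tau_le_theta i j Ts; lra.
  have xr j := solution_range Tt0 hx sx i (Td j) (dr j).
  have yr j := hy i (Td j) (dr j).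
  have nd j : `|x (s - tau i j s) ord0 i - y (s - tau i j s) ord0 i| <=
      N * (B * e s * weight A1 q (x (s - tau i j s) ord0 i)).
    set d := s - tau i j s; case: (leP t0 d) => t0d.
      have ed := decay_gt0 l0 Tt0 (Td j); rewrite -/d in ed.
      have m kap' : `|x d ord0 i - y d ord0 i| <= N * (e d * V kap' i d).
        by apply: gap_norm; apply: below; rewrite ?ds//; split => //=; exact: Td.
      have Ned : 0 < N * e d by rewrite mulr_gt0.
      have mW : `|x d ord0 i - y d ord0 i| <= N * e d * weight A1 q (x d ord0 i).
        rewrite /weight minr_pMr ?(ltW Ned)// le_min; apply/andP; split.
          by have := m false; rewrite /V/=; lra.
        by have := m true; rewrite /V/=; lra.
      (* The weight is nonnegative because it bounds a norm. *)
      have W0 : 0 <= weight A1 q (x d ord0 i).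
        by rewrite -(pmulr_rge0 _ Ned); exact: le_trans mW.
      apply: (le_trans mW); rewrite -mulrA ler_pM2l// ler_wpM2r//.
      exact: decay_delay.
    have hd : hist t0 d by split; [exact: Td|rewrite /= (ltW t0d) andbT; exact: dr].
    have /andP[xd1 _] := hx i hd.
    have WE : weight A1 q (x d ord0 i) = A1.
      apply/min_idPl; rewrite lerDl mulr_ge0 ?subr_ge0//.
      by have /andP[] := q_bounds.
    rewrite WE; apply: (le_trans (hxy i hd)); rewrite ler_pM2l// ler_peMl ?(ltW A1_pos)//.
    by apply: decay_delay0 (ltW t0d).
  have [] := row_weight i Ts xr yr.
  have := sum_norm_le Ss (nk kap) nd.
  set G := \sum_(j < n) _ * (_ * _); set Sb := \sum_(k < n | _) _ * V _ _ _.
  move=> nS K1 K2.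
  have rate := decay_rateP i Ts; rewrite -/B in rate.
  have B1 : 1 <= B.
    rewrite -[leLHS]expR0 ler_expR mulr_ge0 ?(ltW l0)//; exact: theta_ge0 i _ Ts.
  have Gc : G <= supT T (c i) * A1.
    have /andP[_ c2] := ap_nonneg_bounds (c_ap i) Ts.
    have sb0 : 0 <= \sum_(k < n | k != i) b i k s.
      by apply: sumr_ge0 => k' ki; exact: ltW (b_gt0 ki Ts).
    have := ler_wpM2r (ltW A1_pos) c2; have := mulr_ge0 sb0 (ltW A1_pos).
    by have := row_slack_gt0 i; lra.
  have BG : B * G <= G + (B - 1) * (supT T (c i) * A1).
    by have := ler_wpM2l (_ : 0 <= B - 1) Gc; rewrite subr_ge0 => /(_ B1); lra.
  (* V is affine in x, so that the terms b_k x_k of the equation cancel. *)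
  have SbE : Sb = (A1 - slope kap * A1) * (\sum_(k < n | k != i) b i k s) +
      slope kap * \sum_(k < n | k != i) b i k s * x s ord0 k.
    rewrite /Sb !mulr_sumr -big_split/=; apply: eq_bigr => k' _; rewrite /V; ring.
  have pV : - decay_rate * (A1 + q * A2) <= p s * V kap i (sigma (after t0) s).
    have p0 := ltW (ominus_lt0 T l0 s); have p1 := ominus_gt T l0 s.
    have Vm0 : 0 <= A1 + q * A2.
      by have /andP[q0 _] := q_bounds; rewrite addr_ge0 ?(ltW A1_pos)// mulr_ge0// ltW.
    apply: (@le_trans _ _ (p s * (A1 + q * A2))); first by rewrite ler_wpM2r.
    rewrite ler_wnM2l//.
    have Sg : after t0 (sigma (after t0) s) by apply: sigma_mem => //; exact: closed_restrict.
    have xs2 : x (sigma (after t0) s) ord0 i <= A2.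
      case: Sg => Tsg /= t0sg; apply: (solution_upper Tt0 hx sx) => //.
      by have := theta_ge0 i Ts; lra.
    have s0 := slope_ge0 kap; have sq : slope kap <= q by case: (kap) => //=; have /andP[] := q_bounds.
    rewrite /V; have := ler_wpM2l s0 xs2; have := mulr_ge0 s0 (ltW A1_pos).
    by have := ler_wpM2r (ltW A20) sq; lra.
  have bracket : 0 < p s * V kap i (sigma (after t0) s) + slope kap * rhs x i s
      + c i s * V kap i s - Sb - B * G.
    rewrite SbE rhsE /V; case: (kap) => /= in pV *; rewrite /V/= in pV *; lra.
  have Ne : 0 < N * e s by rewrite mulr_gt0.
  have := mulr_gt0 Ne bracket.
  set z := rhs x i s - rhs y i s + _ in nS.
  have hz : - `|z| <= (-1) ^+ sg * z by have := ler_norm (- ((-1) ^+ sg * z)); rewrite normrN normrMsign; lra.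
  rewrite /dgap /gap /=; rewrite /z in hz nS *; lra.
Qed.

Lemma solution_gap_le t i : T t -> t0 <= t ->
  `|x t ord0 i - y t ord0 i| <= N * A1 * e t.
Proof.
move=> Tt t0t; apply: (le_trans (gap_norm (gap_ge0 (i, false, false) Tt t0t) (gap_ge0 (i, false, true) Tt t0t))).
by rewrite /V/=; lra.
Qed.

End Comparison.

Lemma solution_gap_decay t0 (x y : R -> 'rV[R]_n) D : T t0 ->
  (forall s i, hist t0 s -> A1 <= x s ord0 i <= A2) ->
  solution_on c b beta alpha tau (after t0) x ->
  (forall s i, T s -> t0 - theta T tau <= s -> A1 <= y s ord0 i <= A2) ->
  solution_on c b beta alpha tau (after t0) y ->
  0 <= D -> (forall s i, hist t0 s -> `|x s ord0 i - y s ord0 i| <= D) ->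
  forall t i, T t -> t0 <= t -> `|x t ord0 i - y t ord0 i| <= D * decay T decay_rate t0 t.
Proof.
move=> Tt0 hx sx hy sy D0 hD t i Tt t0t.
have e0 := decay_gt0 decay_rate_gt0 Tt0 Tt.
apply/ler_addgt0Pl => d d0; set e := decay _ _ _ _ in e0 *.
have N0 : 0 < (D + d / e) / A1 by rewrite divr_gt0// ltr_wpDl// divr_gt0.
have NE : (D + d / e) / A1 * A1 = D + d / e by rewrite divfK// gt_eqF.
have hN s k : hist t0 s -> `|x s ord0 k - y s ord0 k| <= (D + d / e) / A1 * A1.
  by move=> hs; rewrite NE; apply: (le_trans (hD s k hs)); rewrite lerDl divr_ge0// ltW.
have := solution_gap_le Tt0 N0 hx sx hy sy hN i Tt t0t.
by rewrite NE -/e mulrDl divfK ?gt_eqF//; lra.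
Qed.

Lemma solution_on_after t0 x : solution_on c b beta alpha tau T x ->
  solution_on c b beta alpha tau (after t0) x.
Proof. by move=> sx t i [Tt /= t0t]; apply: delta_derive_restrict => //; exact: sx. Qed.

Lemma bounded_solution_stable (xs : R -> 'rV[R]_n) :
  (forall t i, T t -> A1 <= xs t ord0 i <= A2) -> solution_on c b beta alpha tau T xs ->
  (0 < n)%N -> exponentially_stable T c b beta alpha tau A1 A2 xs.
Proof.
move=> hxs sxs n0; pose i0 : 'I_n := Ordinal n0; have l0 := decay_rate_gt0.
exists decay_rate, 2; split => //; first exact: ominus_positively_regressive.
  by rewrite ltr1n.
move=> t0 Tt0 _ phi x [_ hphi] [xphi sx] t Tt t0t.
pose nrm := initial_norm T tau t0 (fun s => phi s - xs s).
have hx s i : hist t0 s -> A1 <= x s ord0 i <= A2.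
  by move=> hs; rewrite (xphi s hs); exact: hphi.
have hD s i : hist t0 s -> `|x s ord0 i - xs s ord0 i| <= nrm.
  move=> hs; rewrite (xphi s hs).
  apply: le_trans (fmax_ge (fun k => sup [set `|(phi u - xs u) ord0 k| | u in hist t0]) i).
  apply: ub_le_sup; last by exists s => //; rewrite !mxE.
  exists (A2 - A1) => _ [u hu <-]; rewrite !mxE.
  have /andP[p1 p2] := hphi u i hu; have /andP[q1 q2] := hxs u i hu.1.
  by rewrite ler_norml; lra.
have nrm0 : 0 <= nrm := le_trans (normr_ge0 _) (hD t0 i0 (hist_t0 i0 Tt0)).
have gap i : `|x t ord0 i - xs t ord0 i| <= nrm * decay T decay_rate t0 t.
  apply: solution_gap_decay => // [s k Ts _|]; first exact: hxs.
  exact: solution_on_after.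
have e0 := decay_gt0 l0 Tt0 Tt; have eE := decay_le_ts_exp clT l0 Tt0 Tt t0t.
apply: (fmax_le i0) => i; rewrite !mxE; apply: (le_trans (gap i)); rewrite -/nrm.
have := ler_wpM2l nrm0 eE; have := mulr_ge0 nrm0 (le_trans (ltW e0) eE); lra.
Qed.

(** For [t0] below [t], the exponential is at most [1 / (1 + lam (t - t0))]. *)
Lemma bounded_solution_unique (x y : R -> 'rV[R]_n) :
  (forall m, exists2 t, T t & t <= m) ->
  (forall t i, T t -> A1 <= x t ord0 i <= A2) -> solution_on c b beta alpha tau T x ->
  (forall t i, T t -> A1 <= y t ord0 i <= A2) -> solution_on c b beta alpha tau T y ->
  forall t, T t -> x t = y t.
Proof.
move=> Tlow hx sx hy sy t Tt; apply/rowP => i; have l0 := decay_rate_gt0.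
apply/eqP; rewrite -subr_eq0 -normr_eq0; apply/eqP/le_anti; rewrite normr_ge0 andbT.
have A0 : 0 < A2 - A1 by rewrite subr_gt0.
apply/ler_addgt0Pl => d d0; rewrite addr0.
have [t0 Tt0 t0m] := Tlow (t - (A2 - A1) / d / decay_rate).
have k0 : 0 < (A2 - A1) / d / decay_rate by rewrite !divr_gt0.
have t0t : t0 <= t by lra.
have gap : `|x t ord0 i - y t ord0 i| <= (A2 - A1) * decay T decay_rate t0 t.
  apply: solution_gap_decay => //.
  - by move=> s k [Ts _]; exact: hx.
  - exact: solution_on_after.
  - by move=> s k Ts _; exact: hy.
  - exact: solution_on_after.
  - exact: ltW.
  move=> s k [Ts _]; have /andP[p1 p2] := hx s k Ts; have /andP[q1 q2] := hy s k Ts.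
  by rewrite ler_norml; lra.
apply: (le_trans gap); rewrite /decay t0t.
have q0 : 0 < 1 + decay_rate * (t - t0) by rewrite ltr_wpDr// mulr_ge0 ?(ltW l0)// subr_ge0.
apply: (le_trans (ler_wpM2l (ltW A0) (step_inf_upper l0 Tt t0t))).
rewrite ler_pdivrMr// -ler_pdivrMl// mulrC.
have : (A2 - A1) / d / decay_rate <= t - t0 by lra.
by rewrite ler_pdivrMr// mulrC; lra.
Qed.

End System.

(** * Uniqueness and exponential stability *)

Section Final.
Set Implicit Arguments.
Unset Strict Implicit.
Context {R : realType}.

(** The translation numbers form a nonzero subgroup of the reals contained in
    the time scale. *)
Lemma almost_periodic_unbounded_below (T : set R) : almost_periodic_time_scale T ->
  forall m, exists2 t, T t & t <= m.
Proof.
move=> [_ Pi1 [p0 Pp0] Pgrp _] m.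
have P0 : ap_Pi T 0 by have := (Pgrp p0 p0 Pp0 Pp0).2; rewrite subrr.
have [p Pp pn] : exists2 p, ap_Pi T p & p != 0.
  apply: contrapT => h; apply: Pi1; apply/seteqP; split => [q Pq|_ ->//] /=.
  by apply/eqP; apply: contrapT => qn; apply: h; exists q => //; exact/negP.
have [r Pr r0] : exists2 r, ap_Pi T r & r < 0.
  case: (ltrgtP p 0) pn => // p1 _; first by exists p.
  by exists (0 - p); [exact: (Pgrp 0 p P0 Pp).2|rewrite sub0r oppr_lt0].
have Pk k : ap_Pi T (r *+ k).
  by elim: k => [|k IH]; [rewrite mulr0n|rewrite mulrS; exact: (Pgrp r _ Pr IH).1].
pose k := Num.bound `|m / r|.
exists (r *+ k); first by case: (Pk k).
have mk : m / r <= k%:R.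
  by apply: (le_trans (ler_norm _)); apply: ltW; exact: archi_boundP.
have := ler_wnM2l (ltW r0) mk.
by rewrite mulrCA divff ?lt_eqF// mulr1 mulr_natr.
Qed.

End Final.

Theorem theorem4p2 (R : realType) (T : set R) (n : nat)
  (c : 'I_n -> R -> R) (b beta alpha tau : 'I_n -> 'I_n -> R -> R)
  (A1 A2 varsigma : R)
  (hT : almost_periodic_time_scale T) (hn : (0 < n)%N)
  (hvarsigma : 0 < varsigma < 1)
  (hvarsigmaE : (1 - varsigma) / expR varsigma = 1 / expR 2)
  (c_ap : forall i, ap_nonneg T (c i))
  (b_ap : forall i k, k != i -> ap_nonneg T (b i k))
  (beta_ap : forall i j, ap_nonneg T (beta i j))
  (alpha_ap : forall i j, ap_nonneg T (alpha i j))
  (tau_ap : forall i j, ap_nonneg T (tau i j))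
  (c_pos : forall i, 0 < infT T (c i))
  (b_pos : forall i k, k != i -> 0 < infT T (b i k))
  (beta_pos : forall i j, 0 < infT T (beta i j))
  (alpha_pos : forall i j, 0 < infT T (alpha i j))
  (tau_T : forall i j t, T t -> T (t - tau i j t))
  (A1_pos : 0 < A1) (A12 : A1 < A2)
  (A2_gt : fmax (fun i : 'I_n =>
       (1 - \sum_(k < n | k != i) supT T (b i k) / infT T (c i))^-1
       * \sum_(j < n) supT T (beta i j)
           / (infT T (c i) * infT T (alpha i j) * expR 1)) < A2)
  (A1_lt : A1 < fmin (fun i : 'I_n =>
       (1 - \sum_(k < n | k != i) infT T (b i k) / supT T (c i))^-1
       * \sum_(j < n) A2 * (infT T (beta i j) / supT T (c i))
           * expR (- supT T (alpha i j) * A2)))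
  (A1_ge : varsigma
       / fmin (fun ij : 'I_n * 'I_n => infT T (alpha ij.1 ij.2)) <= A1)
  (c_reg : forall i, positively_regressive T (fun t => - c i t))
  (contraction : forall i,
     \sum_(k < n | k != i) supT T (b i k)
     + \sum_(j < n) supT T (beta i j) / expR 2 < infT T (c i))
  (xs : R -> 'rV[R]_n) (xs_region : region T A1 A2 xs)
  (xs_sol : solution_on c b beta alpha tau T xs) :
  (forall y : R -> 'rV[R]_n, region T A1 A2 y ->
     solution_on c b beta alpha tau T y -> forall t, T t -> y t = xs t)
  /\ exponentially_stable T c b beta alpha tau A1 A2 xs.
Proof.
have [[hT0 clT] _ _ _ _] := hT.
have hv : (1 - varsigma) * expR (2 - varsigma) = 1.
  rewrite expRD expRN mulrCA -/(_ / _) hvarsigmaE div1r mulfV// gt_eqF// expR_gt0.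
pose i0 : 'I_n := Ordinal hn.
have Amin0 : 0 < fmin (fun ij : 'I_n * 'I_n => infT T (alpha ij.1 ij.2)).
  by apply: (fmin_gt0 (i0, i0)) => -[i j]; exact: alpha_pos.
have v_le i j : varsigma <= infT T (alpha i j) * A1.
  move: A1_ge; rewrite ler_pdivrMr// => /le_trans; apply; rewrite mulrC ler_wpM2r ?(ltW A1_pos)//.
  exact: (fmin_le (fun ij : 'I_n * 'I_n => infT T (alpha ij.1 ij.2)) (i, j)).
have c_sup i : infT T (c i) <= supT T (c i).
  have [t Tt] := hT0.
  by have /andP[h1 h2] := ap_nonneg_bounds (c_ap i) Tt; exact: le_trans h2.
have beta0 i j : 0 <= supT T (beta i j).
  have [t Tt] := hT0; have /andP[h1 h2] := ap_nonneg_bounds (beta_ap i j) Tt.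
  exact: le_trans (ltW (beta_pos i j)) (le_trans h1 h2).
have b_sup i : \sum_(k < n | k != i) infT T (b i k) <= \sum_(k < n | k != i) supT T (b i k).
  apply: ler_sum => k ki; have [t Tt] := hT0.
  by have /andP[h1 h2] := ap_nonneg_bounds (b_ap i k ki) Tt; exact: le_trans h2.
have cb i : 0 < infT T (c i) - \sum_(k < n | k != i) supT T (b i k).
  have := contraction i.
  have : 0 <= \sum_(j < n) supT T (beta i j) / expR 2.
    by apply: sumr_ge0 => j _; rewrite divr_ge0 ?expR_ge0.
  by lra.
(* Clears the denominators of the conditions on A1 and A2. *)
have quotient (C B S : R) : 0 < C -> 0 < C - B -> (1 - B / C)^-1 * (S / C) = S / (C - B).
  move=> C0 CB; have -> : 1 - B / C = (C - B) / C by rewrite mulrBl divff ?gt_eqF.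
  by rewrite invf_div mulrC -mulrA [C^-1 * _]mulrA mulVf ?mul1r// gt_eqF.
have hA2 i : \sum_(j < n) supT T (beta i j) / (infT T (alpha i j) * expR 1) <
    (infT T (c i) - \sum_(k < n | k != i) supT T (b i k)) * A2.
  have := le_lt_trans (fmax_ge _ i) A2_gt => /=.
  rewrite -mulr_suml.
  have -> : \sum_(j < n) supT T (beta i j) / (infT T (c i) * infT T (alpha i j) * expR 1) =
      (\sum_(j < n) supT T (beta i j) / (infT T (alpha i j) * expR 1)) / infT T (c i).
    rewrite mulr_suml; apply: eq_bigr => j _.
    by rewrite -mulrA invfM [(infT T (c i))^-1 * _]mulrC mulrA.
  by rewrite quotient// ltr_pdivrMr// mulrC.
have hA1 i : (supT T (c i) - \sum_(k < n | k != i) infT T (b i k)) * A1 <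
    \sum_(j < n) infT T (beta i j) * production (supT T (alpha i j)) A2.
  have := lt_le_trans A1_lt (fmin_le _ i) => /=.
  rewrite -mulr_suml.
  have -> : \sum_(j < n) A2 * (infT T (beta i j) / supT T (c i)) * expR (- supT T (alpha i j) * A2) =
      (\sum_(j < n) infT T (beta i j) * production (supT T (alpha i j)) A2) / supT T (c i).
    by rewrite mulr_suml; apply: eq_bigr => j _; rewrite /production; ring.
  rewrite quotient; [|exact: lt_le_trans (c_sup i)|].
    rewrite ltr_pdivlMr; first by rewrite mulrC.
    by have := cb i; have := b_sup i; have := c_sup i; lra.
  by have := cb i; have := b_sup i; have := c_sup i; lra.
have [fl [q fd]] : exists fl q, floor_data varsigma (A2 / A1) fl q.
  by apply: floor_data_exists => //; rewrite ltr_pdivlMr// mul1r.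
have [_ hxs] := xs_region.
split=> [y [_ hy] sy|].
  by apply: (bounded_solution_unique hv clT c_ap b_ap beta_ap alpha_ap tau_ap c_pos b_pos beta_pos alpha_pos tau_T
    A1_pos A12 v_le hA2 hA1 c_reg contraction fd) => //;
    exact: almost_periodic_unbounded_below.
exact: (bounded_solution_stable hv clT c_ap b_ap beta_ap alpha_ap tau_ap c_pos b_pos beta_pos alpha_pos tau_T
    A1_pos A12 v_le hA2 hA1 c_reg contraction fd).
Qed.
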